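(* Let $S$ be a smooth Levi-flat hypersurface of $\mathbb{C}^n=\mathbb{C}^{n-1}_z\times\mathbb{C}_w$, contained in $C=\{(z,w)\in\mathbb{C}^{n-1}\times\mathbb{C}: |w|<1\}$ and closed in $\overline{C}$. Then $S$ is foliated by hyperplanes $\{w=\mathrm{const.}\}$, i.e. the complex leaves of the Levi foliation of $S$ are complex hyperplanes of the form $\{(z,w): w=c\}$, $c\in\mathbb{C}$.
   Context: A smooth real hypersurface $S\subset\mathbb{C}^n$ is Levi flat if it is foliated by complex leaves (immersed complex submanifolds of dimension $n-1$); equivalently, its Levi form vanishes identically. *)

(* Defs.v *)
From HB Require Import structures.
From mathcomp Require Import all_boot all_order all_algebra.
From mathcomp Require Import all_classical all_reals all_analysis.
From mathcomp Require Import complex.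
From Stdlib Require Import Relations.

Set Implicit Arguments.
Unset Strict Implicit.
Unset Printing Implicit Defensive.

Import Order.TTheory GRing.Theory Num.Theory.
Import numFieldNormedType.Exports.

Local Open Scope classical_set_scope.
Local Open Scope ring_scope.

(* C^oo on a (typically open) set: all iterated directional derivatives exist
   and are continuous there. *)
Fixpoint Ck (R : realType) (V W : normedModType R) (k : nat)
    (U : set V) (f : V -> W) : Prop :=
  (forall x, U x -> {for x, continuous f}) /\
  (if k is k'.+1 then
     forall v, (forall x, U x -> derivable f x v) /\ Ck k' U (fun x => 'D_v f x)
   else True).

Definition smooth (R : realType) (V W : normedModType R)
    (U : set V) (f : V -> W) : Prop := forall k, Ck k U f.

Definition closed_in (T : topologicalType) (A B : set T) : Prop :=
  closed (B : set (subspace A)).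

(* R[i] packed as a numClosedFieldType, so that it inherits the normed-module
   structure over itself that numeric fields have; [differentiable] between
   modules over C R is then complex differentiability. *)
Definition C (R : realType) : numClosedFieldType := R[i].

(* C^n = C^m_z x C_w with n = m + 1. *)
Notation Cn R m := ('rV[C R]_m * C R)%type (only parsing).

Section RealCoordinates.
Variables (R : realType) (m : nat).

Definition vec_of_real (x : 'rV[R]_m * 'rV[R]_m) : 'rV[C R]_m :=
  \row_j Complex (x.1 0 j) (x.2 0 j).

Definition real_of_vec (z : 'rV[C R]_m) : 'rV[R]_m * 'rV[R]_m :=
  (\row_j complex.Re (z 0 j : R[i]), \row_j complex.Im (z 0 j : R[i])).

Definition Cn_of_real (x : ('rV[R]_m * 'rV[R]_m) * (R * R)) : Cn R m :=
  (vec_of_real x.1, Complex x.2.1 x.2.2).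

Definition real_of_Cn (p : Cn R m) : ('rV[R]_m * 'rV[R]_m) * (R * R) :=
  (real_of_vec p.1, (complex.Re (p.2 : R[i]), complex.Im (p.2 : R[i]))).

End RealCoordinates.

Section LeviFlat.
Variables (R : realType) (m : nat).

(* Embedded smooth real hypersurface, by local defining functions. *)
Definition smooth_hypersurface (S : set (Cn R m)) : Prop :=
  forall p, S p -> exists (U : set (Cn R m)) (rho : Cn R m -> R),
    [/\ open U, U p,
        smooth (@Cn_of_real R m @^-1` U) (rho \o @Cn_of_real R m),
        S `&` U = [set x | U x /\ rho x = 0]
      & forall x, (S `&` U) x ->
          exists v, 'D_v (rho \o @Cn_of_real R m) (real_of_Cn x) != 0].

Definition polydisc : set 'rV[C R]_m := [set z | forall j, `|z 0 j| < 1].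

(* Phi is a diffeomorphism from polydisc x ]-1, 1[ onto S `&` U, with
   holomorphic slices Phi(., t).  The smooth left inverse Psi, defined on U,
   makes Phi an embedding and its slices complex submanifolds of dimension m. *)
Definition foliated_chart (S U : set (Cn R m))
    (Phi : 'rV[C R]_m -> R -> Cn R m) : Prop :=
  [/\ open U,
      [set Phi p.1 p.2 | p in polydisc `*` `]-1, 1[] = S `&` U,
      smooth [set x : ('rV[R]_m * 'rV[R]_m) * R |
                polydisc (vec_of_real x.1) /\ `]-1, 1[%classic x.2]
        (fun x => real_of_Cn (Phi (vec_of_real x.1) x.2)),
      (exists Psi : Cn R m -> ('rV[R]_m * 'rV[R]_m) * R,
         smooth (@Cn_of_real R m @^-1` U) (Psi \o @Cn_of_real R m) /\
         forall z t, polydisc z -> `]-1, 1[%classic t ->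
           Psi (Phi z t) = (real_of_vec z, t))
    & forall z t, polydisc z -> `]-1, 1[%classic t ->
        differentiable (fun z' => Phi z' t) z].

Definition plaque (Phi : 'rV[C R]_m -> R -> Cn R m) (t : R) : set (Cn R m) :=
  [set Phi z t | z in polydisc].

Definition adapted_chart (S : set (Cn R m)) (F : set (set (Cn R m)))
    (U : set (Cn R m)) (Phi : 'rV[C R]_m -> R -> Cn R m) : Prop :=
  foliated_chart S U Phi /\
  forall t, `]-1, 1[%classic t -> exists2 L, F L & plaque Phi t `<=` L.

Definition same_plaque (S : set (Cn R m)) (F : set (set (Cn R m)))
    (x y : Cn R m) : Prop :=
  exists U Phi t, [/\ adapted_chart S F U Phi, `]-1, 1[%classic t,
                      plaque Phi t x & plaque Phi t y].

(* F is the set of leaves.  The adapted charts make each leaf an immersed complex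
   submanifold of dimension m.  The last clause says that a leaf is connected
   for its leaf topology, which the plaques generate.  No compatibility between
   charts is required: plaques are integral manifolds of the complex tangent
   distribution of S, so two charts agree on the plaques. *)
Definition complex_foliation (S : set (Cn R m)) (F : set (set (Cn R m))) : Prop :=
  [/\ partition F id S,
      forall p, S p -> exists U Phi, adapted_chart S F U Phi /\ U p
    & forall L x y, F L -> L x -> L y ->
        clos_refl_trans _ (same_plaque S F) x y].

Definition levi_flat (S : set (Cn R m)) : Prop :=
  smooth_hypersurface S /\ exists F, complex_foliation S F.

Definition cylinder : set (Cn R m) := [set p | `|p.2| < 1].

Definition hyperplane (c : C R) : set (Cn R m) := [set p | p.2 = c].

End LeviFlat.

Arguments cylinder : clear implicits.
Arguments hyperplane {R} m c.

(* Main.v *)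
(* Let T be a connected component of S and T_z its fiber over z.  If a lies off the
   closure B of the projection of T to the w-plane, 1/|w - a| restricted to the
   leaves is log-subharmonic, so max over T_z of 1/|w - a| is a bounded
   subharmonic function of each coordinate of z, and is constant by Liouville.
   Hence the distance from a to T_z does not depend on z, and letting a approach
   the frontier of B, every frontier point w of B gives a hyperplane {w} x C^(n-1)
   inside T.  Near such a hyperplane the fibers of S are smooth curves, and one side
   of them is off B; so these curves consist of frontier points, and the union of
   the hyperplanes is open and closed in T, i.e. equal to T.
   Thus the hyperplane through each point of S lies in S; it is then tangent to
   the leaf, and coincides with it by connectedness. *)

Require Import Defs.
From HB Require Import structures.
From mathcomp Require Import all_boot all_order all_algebra.
From mathcomp Require Import all_classical all_reals all_analysis.
From mathcomp Require Import complex ring lra.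
From Stdlib Require Import Relations.

Set Implicit Arguments.
Unset Strict Implicit.
Unset Printing Implicit Defensive.

Import Order.TTheory GRing.Theory Num.Theory.
Import numFieldNormedType.Exports.

Local Open Scope classical_set_scope.
Local Open Scope ring_scope.

(** * Calculus along lines *)

Section Lines.
Variables (R : realType) (V W : normedModType R).
Implicit Types (f : V -> W) (x v : V).

(** The fiberwise maximum of 1/|w - a| is only upper semicontinuous, and a priori fibers may be
    empty, so that function is never formed. The Liouville step is replaced by an inequality: given
    a point of T, every fiber obtained by changing one coordinate of its base contains a point no
    farther from a. Repeated over the coordinates, this suffices for frontier points, and it yields
    nonempty fibers as well. If it failed, a sum of smooth functions of the |z_j|^2 and of |w - a|^2
    would have an interior maximum on a compact piece of T, against the second derivative test along
    a leaf disc. The obstacle is that T need not contain a curve over a complex line of the base: a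
    tangent vector can freeze the other m - 1 coordinates only to first order, so the test function
    has to penalize them. Compact pieces exist because S, being closed in the closed cylinder, is
    closed in C^n with bounded w. The argument runs in real coordinates, since [smooth] speaks of
    real directional derivatives; the complex structure survives as a complex linear differential
    attached to each disc. *)

Lemma line_quotient f x v s :
  (fun h : R => h^-1 *: ((fun t : R => f (x + t *: v)) (h *: 1 + s) -
                         f (x + s *: v))) =
  (fun h : R => h^-1 *: (f (h *: v + (x + s *: v)) - f (x + s *: v))).
Proof.
apply/funext => h; congr (_ *: (f _ - _)).
by rewrite [h *: 1]mulr1 scalerDl addrCA.
Qed.

Lemma derivable_line f x v s :
  derivable f (x + s *: v) v -> derivable (fun t : R => f (x + t *: v)) s (1 : R).
Proof. by rewrite /derivable -line_quotient. Qed.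

Lemma derive_line f x v s :
  'D_(1 : R) (fun t : R => f (x + t *: v)) s = 'D_v f (x + s *: v).
Proof. by rewrite /derive line_quotient. Qed.

Lemma is_derive_line f x v s df :
  is_derive (x + s *: v) v f df -> is_derive s (1 : R) (fun t : R => f (x + t *: v)) df.
Proof.
by case=> d e; split; [exact: derivable_line | rewrite derive_line].
Qed.

Lemma cvg_line x v (s : R) : (x + t *: v) @[t --> s] --> x + s *: v.
Proof. by apply: cvgD; [exact: cvg_cst|apply: cvgZr_tmp; exact: cvg_id]. Qed.

Lemma near_line x v (U : set V) : open U -> U x ->
  \forall s \near (0 : R), U (x + s *: v).
Proof.
move=> oU Ux; have := @cvg_line x v 0; rewrite scale0r addr0; apply.
exact: open_nbhs_nbhs.
Qed.

End Lines.

(** * Second-order jets in one real variable and the second derivative test *)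

Section Jet2.
Variable R : realType.
Implicit Types (f g : R -> R) (x a b : R).

(** A relation carrying the values of f' and f'' at x, so that sums, products and composites reduce
    to algebra on a and b. The witness k is f' near x, which a second differentiation at x
    requires. *)
Definition jet2 f x a b := exists k : R -> R,
  [/\ \forall s \near x, is_derive s (1 : R) f (k s), k x = a
    & is_derive x (1 : R) k b].

Lemma jet2_eq f x a b a' b' : jet2 f x a b -> a = a' -> b = b' -> jet2 f x a' b'.
Proof. by move=> + <- <-. Qed.

Lemma jet2_cst (c x : R) : jet2 (cst c) x 0 0.
Proof.
exists (cst 0); split => //; last exact: is_derive_cst.
by near=> s; exact: is_derive_cst.
Unshelve. all: by end_near. Qed.

Lemma jet2D f g x a b a' b' : jet2 f x a b -> jet2 g x a' b' ->
  jet2 (f \+ g) x (a + a') (b + b').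
Proof.
case=> k [fk <- kb] [l [gl <- lb]]; exists (k \+ l); split => //.
- by near=> s; apply: is_deriveD; near: s.
- exact: is_deriveD.
Unshelve. all: by end_near. Qed.

Lemma jet2_sum (I : Type) (r : seq I) (f : I -> R -> R) x (a b : I -> R) :
  (forall i, jet2 (f i) x (a i) (b i)) ->
  jet2 (fun s => \sum_(i <- r) f i s) x (\sum_(i <- r) a i) (\sum_(i <- r) b i).
Proof.
move=> fab; elim: r => [|i r ih].
  under [fun s => _]eq_fun do rewrite big_nil.
  by rewrite !big_nil; exact: jet2_cst.
under [fun s => _]eq_fun do rewrite big_cons.
by rewrite !big_cons; exact: jet2D.
Qed.

Lemma jet2M f g x a b a' b' : jet2 f x a b -> jet2 g x a' b' ->
  jet2 (f \* g) x (f x * a' + g x * a)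
    (f x * b' + g x * b + 2 * (a * a')).
Proof.
case=> k [fk <- kb] [l [gl <- lb]].
exists (f * l + g * k); split; [|by []|].
  near=> s.
  have fs : is_derive s 1 f (k s) by near: s.
  have gs : is_derive s 1 g (l s) by near: s.
  exact: is_deriveM.
have fx := nbhs_singleton fk; have gx := nbhs_singleton gl.
apply: (is_derive_eq (is_deriveD (is_deriveM fx lb) (is_deriveM gx kb))).
by rewrite /GRing.scale /=; ring.
Unshelve. all: by end_near. Qed.

Lemma jet2_comp f g x a b a' b' : jet2 f x a b -> jet2 g (f x) a' b' ->
  jet2 (g \o f) x (a' * a) (b' * a ^+ 2 + a' * b).
Proof.
case=> k [fk <- kb] [l [gl <- lb]].
have fx := nbhs_singleton fk.
have cf : {for x, continuous f}.
  by apply: differentiable_continuous; apply/derivable1_diffP.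
exists ((l \o f) * k); split; [|by []|].
  have gl' := cf _ gl.
  near=> s.
  have fs : is_derive s 1 f (k s) by near: s.
  have gs : is_derive (f s) 1 g (l (f s)) by near: s.
  exact: is_derive1_comp.
apply: (is_derive_eq (is_deriveM (is_derive1_comp lb fx) kb)).
by rewrite /GRing.scale /=; ring.
Unshelve. all: by end_near. Qed.

(** If b > 0, then k vanishes at the maximum x and is positive just to its right, so f increases
    there by the mean value theorem. *)
Lemma jet2_max f x a b : jet2 f x a b -> (\forall s \near x, f s <= f x) ->
  b <= 0.
Proof.
case=> k [fk _ kb] fmax; rewrite leNgt; apply/negP => b0.
have [r /= r0 rk] : exists2 r : R, 0 < r & forall s, `|x - s| < r ->
    is_derive s (1 : R) f (k s) /\ f s <= f x.
  have /nbhs_ballP[r r0 h] : nbhs x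
    [set s | is_derive s (1 : R) f (k s) /\ f s <= f x] by near=> s; split; near: s.
  by exists r => // s; exact: h.
have kx0 : k x = 0.
  have /rk[dfx _] : `|x - x| < r by rewrite subrr normr0.
  have : is_derive x 1 f 0.
    apply: (@derive1_at_max _ f (x - r) (x + r) x).
    - by lra.
    - by move=> t; rewrite in_itv /= => /andP[? ?]; have [[]] := rk t
        ltac:(by rewrite ltr_norml; apply/andP; split; lra).
    - by rewrite in_itv /=; apply/andP; split; lra.
    - by move=> t; rewrite in_itv /= => /andP[? ?]; have [] := rk t
        ltac:(by rewrite ltr_norml; apply/andP; split; lra).
  by move=> h; rewrite -(@derive_val _ _ _ _ _ _ _ dfx) derive_val.
have [e e0 He] : exists2 e : R, 0 < e & forall h, 0 < h < e -> 0 < k (h + x).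
  have : h^-1 *: (k (h *: 1 + x) - k x) @[h --> 0^'] --> b.
    by have [dk <-] := kb; exact: dk.
  move=> /cvgr_gt /(_ 0 b0); rewrite /= near_withinE => /nbhs_ballP[e /= e0 He].
  exists e => // h /andP[h0 he].
  have := He h; rewrite /ball /= sub0r normrN gtr0_norm // => /(_ he).
  by rewrite (gt_eqF h0) => /(_ isT); rewrite kx0 subr0 [h *: 1]mulr1 pmulr_rgt0 // invr_gt0.
have [h [h0 hr hk]] : exists h, [/\ 0 < h, h < r & forall h', 0 < h' < h -> 0 < k (h' + x)].
  have m0 : 0 < Num.min e r by rewrite lt_min e0.
  have [me mr] : Num.min e r <= e /\ Num.min e r <= r by split; rewrite ge_min lexx ?orbT.
  exists (Num.min e r / 2); split; [lra|lra|move=> h' /andP[h'0 h'e]].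
  by apply: He; apply/andP; split; lra.
have [c] : exists2 c, c \in `]x, x + h[%R & f (x + h) - f x = k c * (x + h - x).
  apply: MVT; first by lra.
    by move=> t; rewrite in_itv /= => /andP[? ?]; have [] := rk t
        ltac:(by rewrite ltr_norml; apply/andP; split; lra).
  apply: derivable_within_continuous => t; rewrite in_itv /= => /andP[? ?].
  by have [[]] := rk t ltac:(by rewrite ltr_norml; apply/andP; split; lra).
rewrite in_itv /= => /andP[xc ch] fxh.
have kc : 0 < k c by have := hk (c - x); rewrite subrK; apply; apply/andP; split; lra.
have [_] := rk (x + h) ltac:(by rewrite ltr_norml; apply/andP; split; lra).
have : 0 < k c * (x + h - x) by apply: mulr_gt0 => //; lra.
lra.
Unshelve. all: by end_near. Qed.

End Jet2.

Lemma half_dist_le (R : realFieldType) (e a b c : R) :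
  `|a - c| < e / 2 -> `|b - c| < e / 2 -> `|a - b| <= e.
Proof.
by rewrite !ltr_norml ler_norml => /andP[? ?] /andP[? ?]; apply/andP; split; lra.
Qed.

(** * Mean value theorem along lines and symmetry of mixed derivatives *)

Section DirectionalCalculus.
Variables (R : realType) (V : normedModType R).
Implicit Types (f : V -> R) (x u v : V) (U : set V).

(** The symmetric range |t| <= |s| lets both signs of s share one statement. The intermediate point
    is then only known up to its side of x, which the radii chosen later have to allow for. *)
Lemma mvt_line f x v (s : R) :
  (forall t : R, `|t| <= `|s| -> derivable f (x + t *: v) v) ->
  exists2 c : R, `|c| <= `|s| & f (x + s *: v) - f x = s * 'D_v f (x + c *: v).
Proof.
move=> df; have [s0|s0|<-] := ltrgtP 0 s; last first.
- by exists 0; rewrite // scale0r addr0 subrr mul0r.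
- have [|||c] := @MVT R (fun t => f (x + t *: v))
    (fun t => 'D_v f (x + t *: v)) s 0 => //.
  + move=> t; rewrite in_itv /= => /andP[st t0]; apply: is_derive_line.
    by apply/derivableP/df; rewrite !ltr0_norm // lerN2 ltW.
  + apply: derivable_within_continuous => t; rewrite in_itv /= => /andP[st t0].
    by apply: derivable_line; apply: df; rewrite !ler0_norm // ?lerN2 // ltW.
  + rewrite in_itv /= => /andP[sc c0] e; exists c.
      by rewrite !ltr0_norm // lerN2 ltW.
    by move: e; rewrite scale0r addr0 => e; lra.
- have [|||c] := @MVT R (fun t => f (x + t *: v))
    (fun t => 'D_v f (x + t *: v)) 0 s => //.
  + move=> t; rewrite in_itv /= => /andP[st t0]; apply: is_derive_line.
    by apply/derivableP/df; rewrite !gtr0_norm // ltW.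
  + apply: derivable_within_continuous => t; rewrite in_itv /= => /andP[st t0].
    by apply: derivable_line; apply: df; rewrite !ger0_norm // ltW.
  + rewrite in_itv /= => /andP[sc c0] e; exists c.
      by rewrite !gtr0_norm // ltW.
    by move: e; rewrite scale0r addr0 => e; lra.
Qed.

Lemma is_derive_translate f x u v (df : R) :
  is_derive (x + u) v f df -> is_derive x v (fun y => f (y + u)) df.
Proof.
have E : (fun h : R => h^-1 *: (f (h *: v + x + u) - f (x + u))) =
         (fun h : R => h^-1 *: (f (h *: v + (x + u)) - f (x + u))).
  by apply/funext => h; rewrite addrA.
by case=> d e; split; [move: d; rewrite /derivable /= -E | move: e; rewrite /derive /= -E].
Qed.

(** The mean value theorem is used twice: along u for the increment y -> f (y + r v) - f y, then
    along v for the derivative of f along u. *)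
Let second_difference f x u v (r : R) : 0 < r ->
  (forall s t : R, `|s| <= r -> `|t| <= r -> derivable f (x + s *: u + t *: v) u) ->
  (forall s t : R, `|s| <= r -> `|t| <= r ->
    derivable (fun y => 'D_u f y) (x + s *: u + t *: v) v) ->
  exists s t : R, [/\ `|s| <= r, `|t| <= r &
    f (x + r *: u + r *: v) - f (x + r *: u) - (f (x + r *: v) - f x) =
    r * (r * 'D_v (fun y => 'D_u f y) (x + s *: u + t *: v))].
Proof.
move=> r0 du dvu.
pose F := fun y => f (y + r *: v) - f y.
have dF (s : R) : `|s| <= r -> is_derive (x + s *: u) u F
    ('D_u f (x + s *: u + r *: v) - 'D_u f (x + s *: u)).
  move=> sr; apply: is_deriveB.
    by apply/is_derive_translate/derivableP/du; rewrite // gtr0_norm.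
  apply/derivableP; rewrite -[_ + _]addr0 -(scale0r v).
  by apply: du; rewrite // normr0 ltW.
have [s] := @mvt_line F x u r (fun s sr => @ex_derive _ _ _ _ _ _ _ (dF s
  ltac:(by rewrite -(gtr0_norm r0)))).
rewrite (gtr0_norm r0) => sr.
rewrite (@derive_val _ _ _ _ _ _ _ (dF s sr)) => e1.
have [|t] := @mvt_line (fun y => 'D_u f y) (x + s *: u) v r.
  by move=> t; rewrite (gtr0_norm r0) => tr; apply: dvu.
rewrite (gtr0_norm r0) => tr e2.
by exists s, t; split => //; rewrite -e2 -e1 /F; ring.
Qed.

(** The second difference over the parallelogram with sides r u and r v is symmetric in u and v, so
    one mixed derivative at some point near x equals the other at another point near x. Continuity
    brings both points to x. *)
Lemma schwarz f x u v U : open U -> U x ->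
  (forall y, U y -> derivable f y u) -> (forall y, U y -> derivable f y v) ->
  (forall y, U y -> derivable (fun y => 'D_u f y) y v) ->
  (forall y, U y -> derivable (fun y => 'D_v f y) y u) ->
  {for x, continuous (fun y => 'D_v (fun y => 'D_u f y) y)} ->
  {for x, continuous (fun y => 'D_u (fun y => 'D_v f y) y)} ->
  'D_v (fun y => 'D_u f y) x = 'D_u (fun y => 'D_v f y) x.
Proof.
move=> oU Ux du dv dvu duv cvu cuv.
apply/eqP; rewrite -subr_eq0 -normr_le0; apply/ler_addgt0Pl => /= e e0; rewrite addr0.
have e20 : 0 < e / 2 by rewrite divr_gt0.
have : nbhs x [set y | [/\ U y,
    `|'D_v (fun y => 'D_u f y) x - 'D_v (fun y => 'D_u f y) y| < e / 2 &
    `|'D_u (fun y => 'D_v f y) x - 'D_u (fun y => 'D_v f y) y| < e / 2]].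
  have h0 : nbhs x U by apply: open_nbhs_nbhs.
  have h1 := @cvgr_dist_lt _ _ _ _ (nbhs_filter x) _ _ cvu _ e20.
  have h2 := @cvgr_dist_lt _ _ _ _ (nbhs_filter x) _ _ cuv _ e20.
  move: h0 h1 h2; apply: (@filterS3 _ _ (nbhs_filter x)) => y Uy h1 h2; split;
    [exact: Uy|exact: h1|exact: h2].
move=> /nbhs_ballP[d /= d0 Hd].
(* For |s|, |t| <= r the displacement s u + t v then has norm below d / 2; the summand 1 keeps the
   denominator positive. *)
pose r := d / (2 * (`|u| + `|v| + 1)).
have D0 : 0 < `|u| + `|v| + 1 by rewrite ltr_wpDl ?addr_ge0.
have r0 : 0 < r by rewrite divr_gt0 // mulr_gt0.
have near_x (s t : R) : `|s| <= r -> `|t| <= r -> ball x d (x + s *: u + t *: v).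
  move=> sr tr; rewrite -ball_normE /= -addrA opprD addNKr normrN.
  apply: le_lt_trans (ler_normD _ _) _; rewrite !normrZ.
  have h1 : `|s| * `|u| <= r * `|u| by rewrite ler_wpM2r.
  have h2 : `|t| * `|v| <= r * `|v| by rewrite ler_wpM2r.
  have h3 : r * (`|u| + `|v| + 1) = d / 2 by rewrite /r; field; rewrite gt_eqF.
  have : r * (`|u| + `|v| + 1) = r * `|u| + r * `|v| + r by ring.
  lra.
have near_x' (s t : R) : `|s| <= r -> `|t| <= r -> ball x d (x + t *: v + s *: u).
  by move=> *; rewrite addrAC; apply: near_x.
have [||s [t [sr tr e1]]] := @second_difference f x u v r r0.
- by move=> s t sr tr; apply: du; have [] := Hd _ (near_x s t sr tr).
- by move=> s t sr tr; apply: dvu; have [] := Hd _ (near_x s t sr tr).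
have [||s' [t' [sr' tr' e2]]] := @second_difference f x v u r r0.
- by move=> s' t' sr' tr'; apply: dv; have [] := Hd _ (near_x' _ _ tr' sr').
- by move=> s' t' sr' tr'; apply: duv; have [] := Hd _ (near_x' _ _ tr' sr').
have [_ h1 _] := Hd _ (near_x s t sr tr).
have [_ _ h2] := Hd _ (near_x' _ _ tr' sr').
have rn : r != 0 by rewrite gt_eqF.
have E (P Q a b c d' : R) : a - b - (c - d') = r * (r * P) ->
    a - c - (b - d') = r * (r * Q) -> P = Q.
  by move=> p q; apply: (mulfI rn); apply: (mulfI rn); rewrite -p -q; ring.
rewrite (addrAC x (r *: v) (r *: u)) in e2.
move: h1 h2; rewrite (E _ _ _ _ _ _ e1 e2).
apply: half_dist_le.
Qed.

End DirectionalCalculus.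

(** * Smooth maps *)

Section SmoothMaps.
Variable R : realType.
Implicit Types V W : normedModType R.

Lemma smooth_continuous V W (U : set V) (f : V -> W) x :
  smooth U f -> U x -> {for x, continuous f}.
Proof. by move=> /(_ 0)[+ _] => h; exact: h. Qed.

Lemma smooth_derivable V W (U : set V) (f : V -> W) x v :
  smooth U f -> U x -> derivable f x v.
Proof. by move=> /(_ 1)[_ /(_ v)[+ _]] => h; exact: h. Qed.

Lemma smooth_derive V W (U : set V) (f : V -> W) v :
  smooth U f -> smooth U (fun x => 'D_v f x).
Proof. by move=> sf k; have [_ /(_ v)[]] := sf k.+1. Qed.

Lemma Ck_ext V W k (U : set V) (f g : V -> W) : open U ->
  (forall x, U x -> f x = g x) -> Ck k U f -> Ck k U g.
Proof.
move=> oU; elim: k f g => [|k ih] f g fg [cf df].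
all: have near_fg x : U x -> {near x, f =1 g}.
1,3: by move=> Ux; apply: filterS (open_nbhs_nbhs (conj oU Ux)) => y; exact: fg.
all: split.
1,3: move=> x Ux; have := cf x Ux; rewrite /prop_for /continuous_at (fg x Ux).
1,2: by apply: cvg_trans; apply: near_eq_cvg; exact: near_fg.
  by [].
move=> v; split.
  move=> x Ux; apply: near_eq_derivable (near_fg _ Ux) _.
  by have [h _] := df v; exact: h.
apply: (ih (fun x => 'D_v f x)); last by have [] := df v.
by move=> x Ux; apply: near_eq_derive; exact: near_fg.
Qed.

Lemma is_derive_linear V W (W' : normedModType R) (l : {linear W -> W'})
    (f : V -> W) x v df : continuous l ->
  is_derive x v f df -> is_derive x v (fun y => l (f y)) (l df).
Proof.
move=> cl [dfx <-].
have E : (fun h : R => h^-1 *: (l (f (h *: v + x)) - l (f x))) =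
         l \o (fun h : R => h^-1 *: (f (h *: v + x) - f x)).
  apply/funext => h /=; by rewrite -(linearB l) (linearZ_LR l).
have H : (fun h : R => h^-1 *: (l (f (h *: v + x)) - l (f x))) @ 0^' -->
    l ('D_v f x).
  rewrite E; have := cl ('D_v f x); apply: cvg_comp; exact: dfx.
by split; [apply/cvg_ex; exists (l ('D_v f x))|exact: cvg_lim H].
Qed.

Lemma smooth_linear V W (W' : normedModType R) (l : {linear W -> W'})
    (U : set V) (f : V -> W) : open U -> continuous l ->
  smooth U f -> smooth U (fun x => l (f x)).
Proof.
move=> oU cl sf k; elim: k f sf => [|k ih] f sf.
all: split; first by
  move=> x Ux; apply: (@continuous_comp _ _ _ f l); [exact: smooth_continuous sf Ux|exact: cl].
  by [].
have dl x v : U x -> is_derive x v (fun x => l (f x)) (l ('D_v f x)).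
  by move=> Ux; apply: is_derive_linear => //; apply/derivableP;
     exact: smooth_derivable sf Ux.
move=> v; split; first by move=> x Ux; exact: (@ex_derive _ _ _ _ _ _ _ (dl x v Ux)).
apply: (Ck_ext oU _ (ih _ (smooth_derive v sf))) => x Ux.
by rewrite (@derive_val _ _ _ _ _ _ _ (dl x v Ux)).
Qed.

Section Slice.
Variables (V1 V2 W : normedModType R) (U : set (V1 * V2)) (t : V2).

Lemma slice_quotient (f : V1 * V2 -> W) x v :
  (fun h : R => h^-1 *: (f (h *: v + x, t) - f (x, t))) =
  (fun h : R => h^-1 *: (f (h *: (v, 0) + (x, t)) - f (x, t))).
Proof.
apply/funext => h; congr (_ *: (f _ - _)); congr pair => /=.
by rewrite scaler0 add0r.
Qed.

Lemma derive_slice (f : V1 * V2 -> W) x v :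
  'D_v (fun y => f (y, t)) x = 'D_(v, 0) f (x, t).
Proof. by rewrite /derive /= slice_quotient. Qed.

Lemma smooth_slice (f : V1 * V2 -> W) : smooth U f ->
  smooth [set y | U (y, t)] (fun y => f (y, t)).
Proof.
move=> sf k; elim: k f sf => [|k ih] f sf; split => //.
1,2: move=> x Ux; apply: continuous_comp; last exact: smooth_continuous sf Ux.
1,2: by apply: cvg_pair; [exact: cvg_id|exact: cvg_cst].
move=> v; split.
  move=> x Ux; have : derivable f (x, t) (v, 0) by exact: smooth_derivable sf Ux.
  by rewrite /derivable /= slice_quotient.
have -> : (fun x => 'D_v (fun y => f (y, t)) x) =
          (fun y => (fun z => 'D_(v, 0) f z) (y, t)).
  by apply/funext => x; rewrite derive_slice.
exact: ih (smooth_derive _ sf).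
Qed.

End Slice.

End SmoothMaps.

(** * Chain rule along curves, from directional derivatives alone *)

Section ChainRule.
Variable R : realType.
Implicit Types V W : normedModType R.

(** Stands in for finite dimension: a finite spanning family whose coordinates are bounded by the
    norm. It turns bounds on finitely many directional derivatives into a Lipschitz bound. *)
Definition frame V (I : Type) (r : seq I) (e : I -> V) (c : I -> V -> R) :=
  (forall h, h = \sum_(i <- r) c i h *: e i) /\ (forall i h, `|c i h| <= `|h|).

Definition framed V := exists (I : Type) (r : seq I) (e : I -> V) c, frame r e c.

Lemma framed_scalar : framed R.
Proof.
exists unit, [:: tt], (fun=> 1), (fun=> id); split => // h.
by rewrite big_seq1 [_ *: _]mulr1.
Qed.

Lemma framed_prod V W : framed V -> framed W -> framed (V * W)%type.
Proof.
move=> [I [r [e [c [hE hc]]]]] [J [s [f [d [kE kd]]]]].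
exists (I + J)%type, (map inl r ++ map inr s),
  (fun i => match i with inl i => (e i, 0) | inr j => (0, f j) end),
  (fun i x => match i with inl i => c i x.1 | inr j => d j x.2 end).
split=> [[h k]|[i|j] [h k]] /=.
- rewrite big_cat !big_map /=.
  have fstE (K : Type) (t : seq K) (F : K -> V * W) :
      (\sum_(i <- t) F i).1 = \sum_(i <- t) (F i).1.
    by apply: (big_morph fst).
  have sndE (K : Type) (t : seq K) (F : K -> V * W) :
      (\sum_(i <- t) F i).2 = \sum_(i <- t) (F i).2.
    by apply: (big_morph snd).
  congr pair; rewrite /= ?fstE ?sndE /=.
    rewrite [X in _ + X]big1 ?addr0 => [|i _]; last by rewrite scaler0.
    exact: hE.
  rewrite [X in X + _]big1 ?add0r => [|i _]; last by rewrite scaler0.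
  exact: kE.
- by apply: le_trans (hc _ _) _; rewrite prod_normE /= le_max lexx.
- by apply: le_trans (kd _ _) _; rewrite prod_normE /= le_max lexx orbT.
Qed.

Lemma normr_coord (K : numDomainType) n (x : 'rV[K]_n) j : `|x 0 j| <= `|x|.
Proof.
rewrite [leRHS]/Num.norm /= mx_normE -[leLHS]nngE num_le.
exact: (le_bigmax _ _ (0, j)).
Qed.

Lemma framed_rV m : framed 'rV[R]_m.
Proof.
exists 'I_m, (index_enum 'I_m), (fun j => delta_mx 0 j), (fun j (x : 'rV[R]_m) => x 0 j).
by split=> [h|j h]; [exact: row_sum_delta|exact: normr_coord].
Qed.

(** One frame coordinate is changed at a time; each change is controlled by the mean value theorem
    and a bound M near p on the continuous derivative along e i. *)
Lemma lipschitz_frame V (I : Type) (r : seq I) (e : I -> V) (f : V -> R) U p :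
  open U -> U p -> smooth U f ->
  exists C d : R, [/\ 0 <= C, 0 < d & forall x rho (c : I -> R), ball p d x -> rho < d ->
    (forall i, `|c i| <= rho) ->
    `|f (x + \sum_(i <- r) c i *: e i) - f x| <= C * rho].
Proof.
move=> oU Up sf; elim: r => [|i r [C [d [C0 d0 ih]]]].
  exists 0, 1; split => // x rho c _ _ _.
  by rewrite big_nil addr0 subrr normr0 mul0r.
pose M := `|'D_(e i) f p| + 1.
have : nbhs p [set y | [/\ U y, ball p d y & `|'D_(e i) f y| < M]].
  near=> y; split; near: y; first exact: open_nbhs_nbhs.
    exact: nbhsx_ballx.
  have cf : {for p, continuous (fun y => `|'D_(e i) f y|)}.
    apply: (@continuous_comp _ _ _ (fun y => 'D_(e i) f y) (fun z : R => `|z|)); last exact: norm_continuous.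
    exact: smooth_continuous (smooth_derive _ sf) Up.
  by apply: (cvgr_lt _ cf); rewrite ltrDl.
move=> /nbhs_ballP[d' /= d'0 Hd'].
(* By [mE], a point within m of p, moved along e i by less than m |e i|, remains in both balls. *)
pose m := Num.min d d' / (2 * (1 + `|e i|)).
have D0 : 0 < 1 + `|e i| by rewrite ltr_pwDl.
have min0 : 0 < Num.min d d' by rewrite lt_min d0.
have m0 : 0 < m by rewrite divr_gt0 // mulr_gt0.
have [md md'] : Num.min d d' <= d /\ Num.min d d' <= d'.
  by split; rewrite ge_min lexx ?orbT.
have mE : 2 * (m + m * `|e i|) = Num.min d d'.
  by rewrite /m; field; rewrite gt_eqF.
have me0 : 0 <= m * `|e i| by rewrite mulr_ge0 // ltW.
have M0 : 0 <= M by rewrite addr_ge0.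
exists (C + M), m; split => //; first by rewrite addr_ge0.
move=> x rho c; rewrite -ball_normE /= => xp rm crho.
have near_p (t : R) : `|t| <= rho -> `|p - (x + t *: e i)| < Num.min d d'.
  move=> tr; rewrite opprD addrA; apply: le_lt_trans (ler_normB _ _) _.
  rewrite normrZ.
  have : `|t| * `|e i| <= m * `|e i| by rewrite ler_wpM2r // (le_trans tr) // ltW.
  by lra.
rewrite big_cons addrA -(subrKA (f (x + c i *: e i))).
apply: le_trans (ler_normD _ _) _; rewrite mulrDl; apply: lerD.
  apply: ih => //; last by lra.
  by rewrite -ball_normE /=; apply: lt_le_trans (near_p _ (crho i)) _.
have [|t tc ->] := @mvt_line _ _ f x (e i) (c i).
  move=> t tc; suff [Ux _ _] : [set y | [/\ U y, ball p d y & `|'D_(e i) f y| < M]] (x + t *: e i).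
    exact: smooth_derivable sf Ux.
  apply: Hd'; rewrite -ball_normE /=.
  by apply: lt_le_trans (near_p _ _) md'; exact: le_trans tc (crho i).
rewrite normrM mulrC; apply: ler_pM => //.
have [_ _ /ltW //] := Hd' (x + t *: e i) ltac:(rewrite -ball_normE /=;
  by apply: lt_le_trans (near_p _ _) md'; exact: le_trans tc (crho i)).
Unshelve. all: by end_near. Qed.

Lemma smooth_locally_lipschitz V (f : V -> R) U p : framed V ->
  open U -> U p -> smooth U f ->
  exists C d : R, [/\ 0 <= C, 0 < d & forall x y, ball p d x -> `|y - x| < d ->
    `|f y - f x| <= C * `|y - x|].
Proof.
move=> [I [r [e [c [hE hc]]]]] oU Up sf.
have [C [d [C0 d0 H]]] := lipschitz_frame r e oU Up sf.
exists C, d; split => // x y px yx.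
have := H x `|y - x| (fun i => c i (y - x)) px yx (fun i => hc i _).
by rewrite -hE subrKC.
Qed.

(** [smooth] gives derivatives along straight lines only. Replacing g by its tangent line costs o(h)
    in the argument, hence o(h) in the value by the local Lipschitz bound. *)
Lemma is_derive_curve V (f : V -> R) U (g : R -> V) s w : framed V ->
  open U -> U (g s) -> smooth U f -> is_derive s (1 : R) g w ->
  is_derive s (1 : R) (f \o g) ('D_w f (g s)).
Proof.
move=> frV oU Us sf [dg <-]; set w' := 'D_1 g s.
have [C [d [C0 d0 H]]] := smooth_locally_lipschitz frV oU Us sf.
have H1 : h^-1 *: (f (h *: w' + g s) - f (g s)) @[h --> 0^'] --> 'D_w' f (g s).
  exact: smooth_derivable sf Us.
have dg' : h^-1 *: (g (h *: 1 + s) - g s) @[h --> 0^'] --> w' by exact: dg.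
have z0 : (fun h : R => h *: w' + g s) @ 0^' --> g s.
  rewrite -[X in _ --> X](add0r (g s)) -(scale0r w').
  apply: cvgD; last exact: cvg_cst.
  by apply: cvgZr_tmp; apply: cvg_within.
have H2 : h^-1 *: (f (g (h *: 1 + s)) - f (h *: w' + g s)) @[h --> 0^'] --> (0 : R).
  apply/cvgr0Pnorm_lt => /= e e0.
  have e'0 : 0 < e / (C + 1) by rewrite divr_gt0 // ltr_wpDl.
  have dgq := @cvgr_dist_lt _ _ _ (0 : R)^' _ _ _ dg' _ e'0.
  near=> h.
  have h0 : h != 0 by near: h; exact: nbhs_dnbhs_neq.
  have q : `|w' - h^-1 *: (g (h *: 1 + s) - g s)| < e / (C + 1).
    by near: h; exact: dgq.
  have E : g (h *: 1 + s) - (h *: w' + g s) = - (h *: (w' - h^-1 *: (g (h *: 1 + s) - g s))).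
    by rewrite scalerBr scalerA divff // scale1r opprB opprD addrA addrAC.
  have n : `|g (h *: 1 + s) - (h *: w' + g s)| <= `|h| * (e / (C + 1)).
    by rewrite E normrN normrZ ler_wpM2l // ltW.
  have b : ball (g s) d (h *: w' + g s) by near: h; apply: z0; exact: nbhsx_ballx.
  have hd : `|h| * (e / (C + 1)) < d.
    rewrite -ltr_pdivlMr //.
    near: h; apply: dnbhs0_lt; exact: divr_gt0.
  have := H _ _ b (le_lt_trans n hd).
  rewrite normrZ normfV => L.
  rewrite -ltr_pdivlMl ?invr_gt0 ?normr_gt0 // invrK.
  apply: le_lt_trans L _.
  apply: le_lt_trans (ler_wpM2l C0 n) _.
  rewrite mulrCA ltr_pM2l ?normr_gt0 // mulrA ltr_pdivrMr ?ltr_wpDl //.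
  by rewrite mulrC ltr_pM2l // ltrDl.
have H3 : h^-1 *: ((f \o g) (h *: 1 + s) - (f \o g) s) @[h --> 0^'] --> 'D_w' f (g s).
  rewrite -[X in _ --> X]add0r.
  have -> : (fun h : R => h^-1 *: ((f \o g) (h *: 1 + s) - (f \o g) s)) =
    (fun h : R => h^-1 *: (f (g (h *: 1 + s)) - f (h *: w' + g s))) \+
    (fun h : R => h^-1 *: (f (h *: w' + g s) - f (g s))).
    by apply/funext => h /=; rewrite -scalerDr addrA subrK.
  exact: cvgD H2 H1.
by split; [apply/cvg_ex; exists ('D_w' f (g s))|exact: cvg_lim H3].
Unshelve. all: by end_near. Qed.

End ChainRule.

(** * Real and complex coordinates *)

Section ComplexTopology.
Variable R : realType.

Lemma normC_Complex (a b : R) : `|Complex a b : C R| = (Num.sqrt (a ^+ 2 + b ^+ 2))%:C%C.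
Proof. exact: normc_def. Qed.

Lemma normC_Complex_le (a b : R) : `|Complex a b : C R| <= (`|a| + `|b|)%:C%C.
Proof.
rewrite normC_Complex lecR -[leRHS]ger0_norm ?addr_ge0 // -sqrtr_sqr.
apply: ler_wsqrtr; rewrite sqrrD !real_normK ?num_real // addrAC lerDl.
by rewrite mulrn_wge0 // mulr_ge0.
Qed.

Lemma Re_continuous : continuous (fun z : C R => complex.Re (z : R[i])).
Proof.
move=> z; apply/(@cvgrPdist_lt _ _ _ (nbhs z) (nbhs_filter z)) => e e0.
have eC : (0 : C R) < e%:C%C by rewrite ltcR.
near=> y; have zy : ball z (e%:C%C : C R) y by near: y; exact: nbhsx_ballx.
move: zy; rewrite -ball_normE /= => zy.
by rewrite -ltcR -raddfB; apply: le_lt_trans zy; exact: normc_ge_Re.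
Unshelve. all: by end_near. Qed.

Lemma normc_ge_Im (x : R[i]) : `|complex.Im x|%:C%C <= `|x|.
Proof.
rewrite -[X in `|X|%:C%C]opprK normrN -ReiNIm; apply: le_trans (normc_ge_Re _) _.
by rewrite normrM [X in _ * X](_ : _ = 1) ?mulr1 // normc_def /= expr0n expr1n add0r sqrtr1.
Qed.

Lemma Im_continuous : continuous (fun z : C R => complex.Im (z : R[i])).
Proof.
move=> z; apply/(@cvgrPdist_lt _ _ _ (nbhs z) (nbhs_filter z)) => e e0.
have eC : (0 : C R) < e%:C%C by rewrite ltcR.
near=> y; have zy : ball z (e%:C%C : C R) y by near: y; exact: nbhsx_ballx.
move: zy; rewrite -ball_normE /= => zy.
by rewrite -ltcR -raddfB; apply: le_lt_trans zy; exact: normc_ge_Im.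
Unshelve. all: by end_near. Qed.

Lemma Complex_continuous : continuous (fun p : R * R => Complex p.1 p.2 : C R).
Proof.
move=> p; apply/cvgrPdist_lt => /= e e0.
(* Radii are elements of [C R] here; a positive one is real, which allows it to be halved and
   compared in R. *)
have eE : e = (complex.Re (e : R[i]))%:C%C by rewrite RRe_real // gtr0_real.
have e'0 : 0 < complex.Re (e : R[i]) / 2 by rewrite divr_gt0 // -ltcR -eE.
near=> q.
have h1 : `|p.1 - q.1| < complex.Re (e : R[i]) / 2.
  by near: q; apply: cvgr_dist_lt => //; exact: cvg_fst.
have h2 : `|p.2 - q.2| < complex.Re (e : R[i]) / 2.
  by near: q; apply: cvgr_dist_lt => //; exact: cvg_snd.
rewrite eE; apply: le_lt_trans (normC_Complex_le (p.1 - q.1) (p.2 - q.2)) _.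
by rewrite ltcR; move: (complex.Re _) h1 h2 => r; lra.
Unshelve. all: by end_near. Qed.

Lemma continuous_pair (T U W : topologicalType) (f : T -> U) (g : T -> W) :
  continuous f -> continuous g -> continuous (fun x => (f x, g x)).
Proof. by move=> cf cg x; exact: (cvg_pair (cf x) (cg x)). Qed.

Lemma continuous_fun_comp (T U W : topologicalType) (f : T -> U) (g : U -> W) :
  continuous f -> continuous g -> continuous (fun x => g (f x)).
Proof. by move=> cf cg x; exact: (continuous_comp (cf x) (cg (f x))). Qed.

Lemma continuous_rV (T : topologicalType) (K : numFieldType) n (f : T -> 'rV[K]_n) :
  (forall j, continuous (fun x => f x 0 j)) -> continuous f.
Proof.
move=> cf x; apply/cvg_ballP => e e0.
have : \forall y \near x, forall j, ball (f x 0 j) e (f y 0 j).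
  apply: filter_forall => j.
  by have /cvg_ballP := cf j x; apply.
by apply: filterS => y H; split => // i j; rewrite (ord1 i).
Qed.

End ComplexTopology.

Section RealCoordinates.
Variables (R : realType) (m : nat).
Local Notation V := ('rV[R]_m * 'rV[R]_m)%type.
Local Notation E := (V * (R * R))%type.

Lemma vec_of_realK : cancel (@vec_of_real R m) (@real_of_vec R m).
Proof. by case=> x y; congr pair; apply/rowP => j; rewrite !mxE. Qed.

Lemma real_of_vecK : cancel (@real_of_vec R m) (@vec_of_real R m).
Proof. by move=> z; apply/rowP => j; rewrite !mxE; case: (z 0 j). Qed.

Lemma Cn_of_realK : cancel (@Cn_of_real R m) (@real_of_Cn R m).
Proof. by case=> x [a b]; congr pair; exact: vec_of_realK. Qed.

Lemma real_of_CnK : cancel (@real_of_Cn R m) (@Cn_of_real R m).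
Proof. by case=> z [a b]; congr pair; exact: real_of_vecK. Qed.

Lemma vec_of_real_continuous : continuous (@vec_of_real R m).
Proof.
apply: continuous_rV => j.
have -> : (fun x : V => vec_of_real x 0 j) =
    (fun p : R * R => Complex p.1 p.2 : C R) \o (fun x : V => (x.1 0 j, x.2 0 j)).
  by apply/funext => x /=; rewrite mxE.
apply: continuous_fun_comp; last exact: Complex_continuous.
by apply: continuous_pair; apply: continuous_fun_comp (@coord_continuous _ _ _ _ _);
   move=> x; [exact: cvg_fst|exact: cvg_snd].
Qed.

Lemma real_of_vec_continuous : continuous (@real_of_vec R m).
Proof.
apply: continuous_pair; apply: continuous_rV => j.
  under [fun x => _]eq_fun do rewrite mxE.
  exact: continuous_fun_comp (@coord_continuous _ _ _ _ _) (@Re_continuous R).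
under [fun x => _]eq_fun do rewrite mxE.
exact: continuous_fun_comp (@coord_continuous _ _ _ _ _) (@Im_continuous R).
Qed.

Lemma Cn_of_real_continuous : continuous (@Cn_of_real R m).
Proof.
apply: continuous_pair.
  apply: continuous_fun_comp vec_of_real_continuous.
  by move=> x; exact: cvg_fst.
apply: (@continuous_fun_comp _ _ _ snd (fun p : R * R => Complex p.1 p.2 : C R)).
  by move=> x; exact: cvg_snd.
exact: Complex_continuous.
Qed.

Lemma real_of_Cn_continuous : continuous (@real_of_Cn R m).
Proof.
apply: continuous_pair.
  apply: continuous_fun_comp real_of_vec_continuous.
  by move=> x; exact: cvg_fst.
apply: continuous_pair.
  apply: (@continuous_fun_comp _ _ _ snd (fun z : C R => complex.Re (z : R[i]))) (@Re_continuous R).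
  by move=> x; exact: cvg_snd.
apply: (@continuous_fun_comp _ _ _ snd (fun z : C R => complex.Im (z : R[i]))) (@Im_continuous R).
by move=> x; exact: cvg_snd.
Qed.

Lemma real_of_CnB (p q : Cn R m) : real_of_Cn (p - q) = real_of_Cn p - real_of_Cn q.
Proof.
case: p q => [z [a b]] [z' [c d]]; congr ((_, _), _) => /=.
- by apply/rowP => j; rewrite !mxE raddfB.
- by apply/rowP => j; rewrite !mxE raddfB.
Qed.

Lemma real_of_CnZ (s : R) (p : Cn R m) :
  real_of_Cn ((s%:C%C : C R) *: p) = s *: real_of_Cn p.
Proof.
case: p => [z [a b]]; congr ((_, _), (_, _)) => /=.
- by apply/rowP => j; rewrite !mxE; case: (z 0 j) => c d /=; rewrite mul0r subr0.
- by apply/rowP => j; rewrite !mxE; case: (z 0 j) => c d /=; rewrite mul0r addr0.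
- by rewrite mul0r subr0.
- by rewrite mul0r addr0.
Qed.

Lemma vec_of_realD (x y : V) : vec_of_real (x + y) = vec_of_real x + vec_of_real y :> 'rV[C R]_m.
Proof. by apply/rowP => j; rewrite !mxE. Qed.

Lemma vec_of_realZ (s : R) (x : V) :
  vec_of_real (s *: x) = (s%:C%C : C R) *: vec_of_real x :> 'rV[C R]_m.
Proof.
apply/rowP => j; rewrite !mxE; apply/eqP.
by rewrite eq_complex /= !mul0r subr0 addr0 !eqxx.
Qed.

Definition polydisc_real : set V := [set y | polydisc (vec_of_real y)].

(** Restricting the complex difference quotient to real increments gives the real one, so the real
    directional derivatives are the values of the complex linear differential. *)
Lemma is_derive_holomorphic (f : 'rV[C R]_m -> Cn R m) (y v : V) :
  differentiable f (vec_of_real y) ->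
  is_derive y v (fun y' => real_of_Cn (f (vec_of_real y')))
    (real_of_Cn ('d f (vec_of_real y) (vec_of_real v))).
Proof.
move=> df; set z := vec_of_real y; set u := vec_of_real v.
have H : h^-1 *: (f (h *: u + z) - f z) @[h --> (0 : C R)^'] --> 'd f z u.
  rewrite -deriveE //; exact: diff_derivable.
have c0 : (fun s : R => s%:C%C : C R) @ 0^' --> (0 : C R)^'.
  move=> A /nbhs_ballP[e /= e0 HA].
  have eE : e = (complex.Re (e : R[i]))%:C%C by rewrite RRe_real // gtr0_real.
  apply/nbhs_ballP; exists (complex.Re (e : R[i])) => /=; first by rewrite -ltcR -eE.
  move=> s; rewrite /ball /= !sub0r !normrN => se s0; apply: HA; last first.
    by apply: contra s0 => /eqP[->].
  by rewrite -ball_normE /= sub0r normrN normC_Complex expr0n /= addr0 sqrtr_sqr eE ltcR.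
have H' : real_of_Cn ((s%:C%C : C R)^-1 *: (f ((s%:C%C : C R) *: u + z) - f z))
    @[s --> (0 : R)^'] --> real_of_Cn ('d f z u).
  apply: (@cvg_comp _ _ _
    (fun s : R => (s%:C%C : C R)^-1 *: (f ((s%:C%C : C R) *: u + z) - f z))
    (@real_of_Cn R m)); last exact: real_of_Cn_continuous.
  exact: (@cvg_comp _ _ _ (fun s : R => s%:C%C : C R)
    (fun h : C R => h^-1 *: (f (h *: u + z) - f z)) _ _ _ c0 H).
have E : (fun s : R => s^-1 *: (real_of_Cn (f (vec_of_real (s *: v + y))) - real_of_Cn (f z))) =
    (fun s : R => real_of_Cn ((s%:C%C : C R)^-1 *: (f ((s%:C%C : C R) *: u + z) - f z))).
  apply/funext => s; rewrite -[(s%:C%C : C R)^-1](fmorphV (real_complex R)) real_of_CnZ real_of_CnB.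
  by rewrite vec_of_realD vec_of_realZ.
move: H'; rewrite -E => H'.
by split; [apply/cvg_ex; exists (real_of_Cn ('d f z u))|
  exact: (cvg_lim (@norm_hausdorff _ _) H')].
Qed.

End RealCoordinates.

(** * Holomorphic discs in real coordinates *)

Section HolomorphicDiscs.
Variables (R : realType) (m : nat).
Local Notation V := ('rV[R]_m * 'rV[R]_m)%type.
Local Notation E := (V * (R * R))%type.

(** The index [None] stands for w and [Some j] for z_j, so that one formula covers all m + 1 complex
    coordinates. *)
Definition cre (k : option 'I_m) (x : E) : R :=
  if k is Some j then x.1.1 0 j else x.2.1.
Definition cim (k : option 'I_m) (x : E) : R :=
  if k is Some j then x.1.2 0 j else x.2.2.
Definition param_coord (k : 'I_m + 'I_m) (x : V * R) : R :=
  match k with inl j => x.1.1 0 j | inr j => x.1.2 0 j end.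

Lemma cre_is_linear k : linear (cre k).
Proof. by case: k => [j|] a x y /=; rewrite ?mxE. Qed.
Lemma cim_is_linear k : linear (cim k).
Proof. by case: k => [j|] a x y /=; rewrite ?mxE. Qed.
Lemma param_coord_is_linear k : linear (param_coord k).
Proof. by case: k => j a x y /=; rewrite ?mxE. Qed.

HB.instance Definition _ k := GRing.isLinear.Build R E R _ (cre k) (cre_is_linear k).
HB.instance Definition _ k := GRing.isLinear.Build R E R _ (cim k) (cim_is_linear k).
HB.instance Definition _ k :=
  GRing.isLinear.Build R (V * R)%type R _ (param_coord k) (param_coord_is_linear k).

Lemma fst_continuous (T U : topologicalType) : continuous (@fst T U).
Proof. by move=> x; exact: cvg_fst. Qed.
Lemma snd_continuous (T U : topologicalType) : continuous (@snd T U).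
Proof. by move=> x; exact: cvg_snd. Qed.

Lemma cre_continuous k : continuous (cre k).
Proof.
case: k => [j|]; last exact: continuous_fun_comp (@snd_continuous _ _) (@fst_continuous _ _).
apply: continuous_fun_comp (@coord_continuous _ _ _ 0 j).
exact: continuous_fun_comp (@fst_continuous _ _) (@fst_continuous _ _).
Qed.

Lemma cim_continuous k : continuous (cim k).
Proof.
case: k => [j|]; last exact: continuous_fun_comp (@snd_continuous _ _) (@snd_continuous _ _).
apply: continuous_fun_comp (@coord_continuous _ _ _ 0 j).
exact: continuous_fun_comp (@fst_continuous _ _) (@snd_continuous _ _).
Qed.

Lemma param_coord_continuous k : continuous (param_coord k).
Proof.
case: k => j; apply: continuous_fun_comp (@coord_continuous _ _ _ 0 j).
  exact: continuous_fun_comp (@fst_continuous _ _) (@fst_continuous _ _).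
exact: continuous_fun_comp (@fst_continuous _ _) (@snd_continuous _ _).
Qed.

Lemma is_derive_cre (W : normedModType R) (f : W -> E) x v df k :
  is_derive x v f df -> is_derive x v (fun y => cre k (f y)) (cre k df).
Proof. exact: (@is_derive_linear R W E R (cre k) f x v df (@cre_continuous k)). Qed.

Lemma is_derive_cim (W : normedModType R) (f : W -> E) x v df k :
  is_derive x v f df -> is_derive x v (fun y => cim k (f y)) (cim k df).
Proof. exact: (@is_derive_linear R W E R (cim k) f x v df (@cim_continuous k)). Qed.

Lemma framedE : framed E.
Proof.
by do ![apply: framed_prod | exact: framed_rV | exact: framed_scalar].
Qed.

Lemma polydisc_realE (y : V) :
  polydisc_real y <-> forall j, y.1 0 j ^+ 2 + y.2 0 j ^+ 2 < 1.
Proof.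
have H j : (`|(vec_of_real y : 'rV[C R]_m) 0 j| < 1) = (y.1 0 j ^+ 2 + y.2 0 j ^+ 2 < 1).
  rewrite mxE normC_Complex -[1](_ : 1%:C%C = 1) // ltcR -{1}sqrtr1.
  by rewrite ltr_sqrt.
by split=> h j; [rewrite -H|rewrite H]; exact: h.
Qed.

Lemma open_polydisc_real : open (@polydisc_real R m).
Proof.
rewrite openE => y /polydisc_realE hy.
have : \forall y' \near y, forall j, (y' : V).1 0 j ^+ 2 + (y' : V).2 0 j ^+ 2 < 1.
  apply: (@filter_forall _ _ (fun j (y' : V) => y'.1 0 j ^+ 2 + y'.2 0 j ^+ 2 < 1)
    (nbhs y) (nbhs_filter y)) => j.
  have c : {for y, continuous (fun y' : V => y'.1 0 j ^+ 2 + y'.2 0 j ^+ 2)}.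
    have c1 : continuous (fun y' : V => y'.1 0 j).
      exact: continuous_fun_comp (@fst_continuous _ _) (@coord_continuous _ _ _ 0 j).
    have c2 : continuous (fun y' : V => y'.2 0 j).
      exact: continuous_fun_comp (@snd_continuous _ _) (@coord_continuous _ _ _ 0 j).
    by apply: cvgD; apply: cvgM; [exact: c1|exact: c1|exact: c2|exact: c2].
  by apply: (cvgr_lt _ c); exact: hy.
by apply: filterS => y' h; apply/polydisc_realE.
Qed.

Lemma polydisc_real_convex (y y' : V) (t : R) : polydisc_real y -> polydisc_real y' ->
  0 <= t <= 1 -> polydisc_real (y + t *: (y' - y)).
Proof.
move=> /polydisc_realE h /polydisc_realE h' /andP[t0 t1].
apply/polydisc_realE => j; move: (h j) (h' j); rewrite !mxE.
move: (y.1 0 j) (y.2 0 j) (y'.1 0 j) (y'.2 0 j) => a b c d ab cd.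
have -> : (a + t * (c - a)) ^+ 2 + (b + t * (d - b)) ^+ 2 =
  (1 - t) * (a ^+ 2 + b ^+ 2) + t * (c ^+ 2 + d ^+ 2) -
  t * (1 - t) * ((c - a) ^+ 2 + (d - b) ^+ 2) by ring.
have p : 0 <= t * (1 - t) * ((c - a) ^+ 2 + (d - b) ^+ 2).
  by apply: mulr_ge0; [apply: mulr_ge0; lra|rewrite addr_ge0 ?sqr_ge0].
have [->|tn0] := eqVneq t 0; first by lra.
have tp : 0 < t by rewrite lt_def tn0.
have : t * (c ^+ 2 + d ^+ 2) < t * 1 by rewrite ltr_pM2l.
have : (1 - t) * (a ^+ 2 + b ^+ 2) <= (1 - t) * 1 by rewrite ler_wpM2l ?subr_ge0 // ltW.
lra.
Qed.

(** A parametrized piece of leaf. Holomorphy is recorded by the complex linearity of A, immersivity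
    by its injectivity. *)
Definition holo_disc (S : set E) (G : V -> E) : Prop :=
  [/\ smooth (@polydisc_real R m) G,
      (forall y, polydisc_real y -> S (G y)) &
      forall y, polydisc_real y -> exists A : {linear 'rV[C R]_m -> Cn R m},
        (forall u, A u = 0 -> u = 0) /\
        forall v, is_derive y v G (real_of_Cn (A (vec_of_real v)))].

Lemma smooth_subset (V1 W1 : normedModType R) (U U' : set V1) (f : V1 -> W1) :
  U' `<=` U -> smooth U f -> smooth U' f.
Proof.
move=> UU' sf k; elim: k f sf => [|k ih] f sf.
  by split => // x /UU' Ux; exact: smooth_continuous sf Ux.
split; first by move=> x /UU' Ux; exact: smooth_continuous sf Ux.
move=> v; split; first by move=> x /UU' Ux; exact: smooth_derivable sf Ux.
exact: ih (smooth_derive v sf).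
Qed.

Lemma open_Cn_of_real (U : set (Cn R m)) : open U -> open (@Cn_of_real R m @^-1` U).
Proof. by move=> oU; apply: open_comp => // x _; exact: Cn_of_real_continuous. Qed.

(** Injectivity of the differential comes from the smooth left inverse: if A kills v, the curve s ->
    Phi (y + s v, t) has zero velocity at 0, and so has its image under Psi, whose velocity is (v,
    0). The chain rule being for real-valued functions, Psi is read coordinate by coordinate. *)
Lemma chart_disc (S U : set (Cn R m)) Phi (t : R) : foliated_chart S U Phi ->
  `]-1, 1[%classic t ->
  holo_disc (@Cn_of_real R m @^-1` S) (fun y => real_of_Cn (Phi (vec_of_real y) t)).
Proof.
move=> [oU SU sPhi [Psi [sPsi PsiK]] hol] t1.
have sG : smooth (@polydisc_real R m) (fun y => real_of_Cn (Phi (vec_of_real y) t)).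
  by apply: smooth_subset (smooth_slice t sPhi).
have inSU y : polydisc_real y -> (S `&` U) (Phi (vec_of_real y) t).
  by move=> hy; rewrite -SU; exists (vec_of_real y, t).
split => //.
  by move=> y /inSU[? _]; rewrite /preimage /= real_of_CnK.
move=> y hy; have dPhi := hol _ _ hy t1.
exists ('d (fun z => Phi z t) (vec_of_real y)); split; last first.
  by move=> v; apply: is_derive_holomorphic.
move=> u u0; rewrite -(real_of_vecK u); set v := real_of_vec u.
pose g := fun s : R => real_of_Cn (Phi (vec_of_real (y + s *: v)) t).
have dg : is_derive (0 : R) (1 : R) g 0.
  apply: (@is_derive_line _ _ _ (fun y' => real_of_Cn (Phi (vec_of_real y') t)) y v 0 0).
  rewrite scale0r addr0.
  have := is_derive_holomorphic v dPhi.
  rewrite /v real_of_vecK u0 (_ : real_of_Cn 0 = 0) //.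
  by congr ((_, _), _); apply/rowP => j; rewrite !mxE.
have v0 k : param_coord k (v, 0) = 0.
  have sk := smooth_linear (open_Cn_of_real oU) (@param_coord_continuous k) sPsi.
  have Ug0 : (@Cn_of_real R m @^-1` U) (g 0).
    by rewrite /preimage /= real_of_CnK scale0r addr0; have [] := inSU _ hy.
  have := is_derive_curve framedE (open_Cn_of_real oU) Ug0 sk dg.
  rewrite derive0 => d0.
  have d1 : is_derive (0 : R) (1 : R)
      (fun s : R => param_coord k ((y, t) + s *: (v, 0))) (param_coord k (v, 0)).
    apply: is_derive_line; apply: (is_derive_linear (l := param_coord k) (f := id)).
    exact: param_coord_continuous.
  have near_g : \forall s \near (0 : R),
      param_coord k ((y, t) + s *: (v, 0)) =
      ((fun x => param_coord k ((Psi \o @Cn_of_real R m) x)) \o g) s.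
    have := near_line v open_polydisc_real hy; apply: filterS => s hs /=.
    rewrite real_of_CnK PsiK // vec_of_realK; congr param_coord.
    by apply: injective_projections; rewrite /= ?scaler0 ?addr0.
  have d2 := near_eq_is_derive near_g d1.
  by rewrite -(@derive_val _ _ _ _ _ _ _ d2) (@derive_val _ _ _ _ _ _ _ d0).
suff -> : v = 0 by apply/rowP => j; rewrite !mxE.
move: v v0 {g dg} => [v1 v2] v0; congr pair; apply/rowP => j; rewrite !mxE.
  exact: (v0 (inl j)).
exact: (v0 (inr j)).
Qed.

End HolomorphicDiscs.

(** * The maximum principle on leaves *)

Section LeviTest.
Variables (R : realType) (m : nat).
Local Notation V := ('rV[R]_m * 'rV[R]_m)%type.
Local Notation E := (V * (R * R))%type.

Lemma smooth_jet (W : normedModType R) (U : set W) (f : W -> R) x v :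
  open U -> U x -> smooth U f ->
  jet2 (fun s => f (x + s *: v)) 0 ('D_v f x) ('D_v (fun y => 'D_v f y) x).
Proof.
move=> oU Ux sf; exists (fun s => 'D_v f (x + s *: v)).
rewrite scale0r addr0; split; [|by []|].
  have := near_line v oU Ux; apply: filterS => s Us.
  by apply: is_derive_line; apply/derivableP; exact: smooth_derivable sf Us.
apply: (@is_derive_line _ _ _ (fun y => 'D_v f y)); rewrite scale0r addr0.
by apply/derivableP; exact: smooth_derivable (smooth_derive v sf) Ux.
Qed.

Definition rot (v : V) : V := (- v.2, v.1).

Lemma vec_of_rot v : vec_of_real (rot v) = ('i%C : C R) *: vec_of_real v :> 'rV[C R]_m.
Proof.
apply/rowP => j; rewrite !mxE; apply/eqP.
by rewrite eq_complex /= !(mul0r, mul1r, sub0r, add0r) !eqxx.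
Qed.

Lemma cre_i k (p : Cn R m) : cre k (real_of_Cn (('i%C : C R) *: p)) = - cim k (real_of_Cn p).
Proof.
case: p => [z [a b]]; case: k => [j|] /=; last by rewrite mul0r mul1r sub0r.
by rewrite !mxE; case: (z 0 j) => c d /=; rewrite mul0r mul1r sub0r.
Qed.

Lemma cim_i k (p : Cn R m) : cim k (real_of_Cn (('i%C : C R) *: p)) = cre k (real_of_Cn p).
Proof.
case: p => [z [a b]]; case: k => [j|] /=; last by rewrite mul0r mul1r add0r.
by rewrite !mxE; case: (z 0 j) => c d /=; rewrite mul0r mul1r add0r.
Qed.

Section Disc.
Variables (S : set E) (G : V -> E).
Hypothesis hG : holo_disc S G.

Lemma smooth_cre k : smooth (@polydisc_real R m) (fun y => cre k (G y)).
Proof.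
have [sG _ _] := hG.
exact: (smooth_linear (@open_polydisc_real R m) (@cre_continuous R m k) sG).
Qed.

Lemma smooth_cim k : smooth (@polydisc_real R m) (fun y => cim k (G y)).
Proof.
have [sG _ _] := hG.
exact: (smooth_linear (@open_polydisc_real R m) (@cim_continuous R m k) sG).
Qed.

Lemma cauchy_riemann k (y v : V) : polydisc_real y ->
  'D_(rot v) (fun y => cre k (G y)) y = - 'D_v (fun y => cim k (G y)) y /\
  'D_(rot v) (fun y => cim k (G y)) y = 'D_v (fun y => cre k (G y)) y.
Proof.
move=> hy; have [_ _ /(_ y hy)[A [_ dA]]] := hG.
have dre w := is_derive_cre k (dA w).
have dim w := is_derive_cim k (dA w).
rewrite !(@derive_val _ _ _ _ _ _ _ (dre _)) !(@derive_val _ _ _ _ _ _ _ (dim _)).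
by rewrite vec_of_rot linearZ /= cre_i cim_i.
Qed.

(** Harmonicity on the complex line spanned by v: the Cauchy-Riemann equations trade i v for v in
    the inner derivative, Schwarz's theorem exchanges the two derivatives, and the equations apply
    once more. *)
Lemma laplace_re k (y v : V) : polydisc_real y ->
  'D_(rot v) (fun y => 'D_(rot v) (fun y => cre k (G y)) y) y =
  - 'D_v (fun y => 'D_v (fun y => cre k (G y)) y) y.
Proof.
move=> hy; have oP := @open_polydisc_real R m.
have near_y (Q : V -> Prop) : (forall z, polydisc_real z -> Q z) -> \forall z \near y, Q z.
  by move=> H; apply: filterS (open_nbhs_nbhs (conj oP hy)) => z; exact: H.
have sY := smooth_cim k; have sX := smooth_cre k.
transitivity ('D_(rot v) (- (fun y => 'D_v (fun y => cim k (G y)) y)) y).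
  by apply: near_eq_derive; apply: near_y => z hz; have [+ _] := cauchy_riemann k v hz; apply.
transitivity (- 'D_(rot v) (fun y => 'D_v (fun y => cim k (G y)) y) y).
  by apply: deriveN; exact: smooth_derivable (smooth_derive v sY) hy.
apply: (congr1 -%R).
transitivity ('D_v (fun y => 'D_(rot v) (fun y => cim k (G y)) y) y); last first.
  by apply: near_eq_derive; apply: near_y => z hz; have [_ +] := cauchy_riemann k v hz; apply.
apply: (schwarz oP hy).
- by move=> z hz; exact: smooth_derivable sY hz.
- by move=> z hz; exact: smooth_derivable sY hz.
- by move=> z hz; exact: smooth_derivable (smooth_derive _ sY) hz.
- by move=> z hz; exact: smooth_derivable (smooth_derive _ sY) hz.
- exact: smooth_continuous (smooth_derive _ (smooth_derive _ sY)) hy.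
- exact: smooth_continuous (smooth_derive _ (smooth_derive _ sY)) hy.
Qed.

Lemma laplace_im k (y v : V) : polydisc_real y ->
  'D_(rot v) (fun y => 'D_(rot v) (fun y => cim k (G y)) y) y =
  - 'D_v (fun y => 'D_v (fun y => cim k (G y)) y) y.
Proof.
move=> hy; have oP := @open_polydisc_real R m.
have near_y (Q : V -> Prop) : (forall z, polydisc_real z -> Q z) -> \forall z \near y, Q z.
  by move=> H; apply: filterS (open_nbhs_nbhs (conj oP hy)) => z; exact: H.
have sY := smooth_cim k; have sX := smooth_cre k.
transitivity ('D_(rot v) (fun y => 'D_v (fun y => cre k (G y)) y) y).
  by apply: near_eq_derive; apply: near_y => z hz; have [_ +] := cauchy_riemann k v hz; apply.
transitivity ('D_v (fun y => 'D_(rot v) (fun y => cre k (G y)) y) y); last first.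
  transitivity ('D_v (- (fun y => 'D_v (fun y => cim k (G y)) y)) y).
    by apply: near_eq_derive; apply: near_y => z hz; have [+ _] := cauchy_riemann k v hz; apply.
  by apply: deriveN; exact: smooth_derivable (smooth_derive v sY) hy.
apply: (schwarz oP hy).
- by move=> z hz; exact: smooth_derivable sX hz.
- by move=> z hz; exact: smooth_derivable sX hz.
- by move=> z hz; exact: smooth_derivable (smooth_derive _ sX) hz.
- by move=> z hz; exact: smooth_derivable (smooth_derive _ sX) hz.
- exact: smooth_continuous (smooth_derive _ (smooth_derive _ sX)) hy.
- exact: smooth_continuous (smooth_derive _ (smooth_derive _ sX)) hy.
Qed.

End Disc.

Lemma jet2_sqdist (X Y : R -> R) (a b x1 x2 y1 y2 : R) :
  jet2 X 0 x1 x2 -> jet2 Y 0 y1 y2 ->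
  jet2 (fun s => (X s - a) ^+ 2 + (Y s - b) ^+ 2) 0
    (2 * ((X 0 - a) * x1 + (Y 0 - b) * y1))
    (2 * ((X 0 - a) * x2 + (Y 0 - b) * y2 + x1 ^+ 2 + y1 ^+ 2)).
Proof.
move=> jX jY.
have jXa := jet2D jX (jet2_cst (- a) 0); have jYb := jet2D jY (jet2_cst (- b) 0).
apply: jet2_eq (jet2D (jet2M jXa jXa) (jet2M jYb jYb)) _ _; rewrite /=; ring.
Qed.

Lemma jet2_max_sum (I : finType) (X Y psi : I -> R -> R)
    (a b p1 p2 x0 x1 x2 y0 y1 y2 : I -> R) :
  (forall k, X k 0 = x0 k) -> (forall k, Y k 0 = y0 k) ->
  (forall k, jet2 (X k) 0 (x1 k) (x2 k)) -> (forall k, jet2 (Y k) 0 (y1 k) (y2 k)) ->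
  (forall k, jet2 (psi k) ((x0 k - a k) ^+ 2 + (y0 k - b k) ^+ 2) (p1 k) (p2 k)) ->
  (\forall s \near 0,
     \sum_k psi k ((X k s - a k) ^+ 2 + (Y k s - b k) ^+ 2) <=
     \sum_k psi k ((X k 0 - a k) ^+ 2 + (Y k 0 - b k) ^+ 2)) ->
  \sum_k (p2 k * (2 * ((x0 k - a k) * x1 k + (y0 k - b k) * y1 k)) ^+ 2 +
    p1 k * (2 * ((x0 k - a k) * x2 k + (y0 k - b k) * y2 k + x1 k ^+ 2 + y1 k ^+ 2))) <= 0.
Proof.
move=> X0 Y0 jX jY jpsi; apply: jet2_max.
  apply: jet2_sum => k.
  have := jet2_comp (jet2_sqdist (a k) (b k) (jX k) (jY k)).
  by rewrite X0 Y0 => /(_ _ _ _ (jpsi k)); exact.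
Qed.

Definition sqdist (a b : R) k (x : E) := (cre k x - a) ^+ 2 + (cim k x - b) ^+ 2.

(* Adding the second derivatives along v and i v, harmonicity of the coordinates
   of the disc cancels all terms but the Levi form of the test function. *)
Lemma levi_max (S : set E) (G : V -> E) (y v : V) (A : {linear 'rV[C R]_m -> Cn R m})
    (a b : option 'I_m -> R) (psi : option 'I_m -> R -> R) (p1 p2 : option 'I_m -> R) :
  holo_disc S G -> polydisc_real y ->
  is_derive y v G (real_of_Cn (A (vec_of_real v))) ->
  (forall k, jet2 (psi k) (sqdist (a k) (b k) k (G y)) (p1 k) (p2 k)) ->
  (\forall y' \near y, \sum_k psi k (sqdist (a k) (b k) k (G y')) <=
                      \sum_k psi k (sqdist (a k) (b k) k (G y))) ->
  \sum_k (p1 k + sqdist (a k) (b k) k (G y) * p2 k) *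
    ((cre k (real_of_Cn (A (vec_of_real v)))) ^+ 2 +
     (cim k (real_of_Cn (A (vec_of_real v)))) ^+ 2) <= 0.
Proof.
move=> hG hy dA jpsi loc_max.
set u := real_of_Cn _.
have oP := @open_polydisc_real R m.
pose X k z := cre k (G z); pose Y k z := cim k (G z).
have Xv k : 'D_v (X k) y = cre k u.
  by rewrite (@derive_val _ _ _ _ _ _ _ (is_derive_cre k dA)).
have Yv k : 'D_v (Y k) y = cim k u.
  by rewrite (@derive_val _ _ _ _ _ _ _ (is_derive_cim k dA)).
pose x k := X k y - a k; pose z k := Y k y - b k.
pose c k := 'D_v (fun y => 'D_v (X k) y) y; pose d k := 'D_v (fun y => 'D_v (Y k) y) y.
have y0 (w : V) : y + (0 : R) *: w = y by rewrite scale0r addr0.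
have max_line w : \forall s \near (0 : R),
    \sum_k psi k (sqdist (a k) (b k) k (G (y + s *: w))) <=
    \sum_k psi k (sqdist (a k) (b k) k (G (y + 0 *: w))).
  by have := @cvg_line _ _ y w 0; rewrite y0 => /(_ _ loc_max).
have h1 : \sum_k (p2 k * (2 * (x k * cre k u + z k * cim k u)) ^+ 2 +
    p1 k * (2 * (x k * c k + z k * d k + cre k u ^+ 2 + cim k u ^+ 2))) <= 0.
  apply: (@jet2_max_sum _ (fun k s => X k (y + s *: v)) (fun k s => Y k (y + s *: v)) psi
    a b p1 p2 (fun k => X k y) _ _ (fun k => Y k y) _ _ _ _ _ _ jpsi (max_line v)) => k.
  - by rewrite y0.
  - by rewrite y0.
  - by rewrite -Xv; exact: (smooth_jet v oP hy (smooth_cre hG k)).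
  - by rewrite -Yv; exact: (smooth_jet v oP hy (smooth_cim hG k)).
have h2 : \sum_k (p2 k * (2 * (x k * - cim k u + z k * cre k u)) ^+ 2 +
    p1 k * (2 * (x k * - c k + z k * - d k + (- cim k u) ^+ 2 + cre k u ^+ 2))) <= 0.
  apply: (@jet2_max_sum _ (fun k s => X k (y + s *: rot v)) (fun k s => Y k (y + s *: rot v)) psi
    a b p1 p2 (fun k => X k y) _ _ (fun k => Y k y) _ _ _ _ _ _ jpsi (max_line (rot v))) => k.
  - by rewrite y0.
  - by rewrite y0.
  - rewrite -Yv; have [<- _] := cauchy_riemann hG k v hy; rewrite -(laplace_re hG) //.
    exact: (smooth_jet (rot v) oP hy (smooth_cre hG k)).
  - rewrite -Xv; have [_ <-] := cauchy_riemann hG k v hy; rewrite -(laplace_im hG) //.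
    exact: (smooth_jet (rot v) oP hy (smooth_cim hG k)).
(* The second derivatives c and d cancel, and the squares combine by (x p + z q)^2 + (z p - x q)^2 =
   (x^2 + z^2)(p^2 + q^2), where p and q are the real and imaginary parts of u in coordinate k. *)
have : 4 * \sum_k (p1 k + sqdist (a k) (b k) k (G y) * p2 k) * (cre k u ^+ 2 + cim k u ^+ 2) <= 0.
  have := lerD h1 h2; rewrite addr0; apply: le_trans.
  rewrite -big_split mulr_sumr /= le_eqVlt; apply/orP; left; apply/eqP.
  by apply: eq_bigr => k _; rewrite /sqdist -/(X k y) -/(Y k y) -/(x k) -/(z k); ring.
by rewrite pmulr_rle0.
Qed.

End LeviTest.

(** * Liouville's theorem for the fibers *)

Section InteriorMaximum.
Variables (R : realType) (m : nat).
Local Notation V := ('rV[R]_m * 'rV[R]_m)%type.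
Local Notation E := (V * (R * R))%type.

Definition laminated (T : set E) := forall x, T x ->
  exists G y, [/\ holo_disc T G, polydisc_real y & G y = x].

Definition coord_dist (c : E) k (x : E) : R := sqdist (cre k c) (cim k c) k x.

Lemma coord_dist_ge0 c k x : 0 <= coord_dist c k x.
Proof. by rewrite addr_ge0 ?sqr_ge0. Qed.

Lemma coord_dist_continuous c k : continuous (coord_dist c k).
Proof.
have h1 : continuous (fun x : E => cre k x - cre k c).
  by move=> x; apply: cvgB; [exact: cre_continuous|exact: cvg_cst].
have h2 : continuous (fun x : E => cim k x - cim k c).
  by move=> x; apply: cvgB; [exact: cim_continuous|exact: cvg_cst].
by move=> x; apply: cvgD; apply: cvgM; [exact: h1|exact: h1|exact: h2|exact: h2].
Qed.

(** There are m - 1 linear conditions on m unknowns. To stay with square matrices, D zeroes column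
    j1 of the matrix of the z-part of A, and the determinant vanishes. *)
Lemma kernel_vector (A : {linear 'rV[C R]_m -> Cn R m}) (j1 : 'I_m) :
  exists2 w, w != 0 & forall j, j != j1 -> (A w).1 0 j = 0.
Proof.
pose D := diag_mx (\row_j ((j != j1)%:R : C R)).
pose M := lin1_mx (fst \o A) *m D.
have detM : \det M == 0.
  rewrite det_mulmx det_diag (bigD1 j1) //= mxE eqxx mul0r mulr0 //.
have /det0P[w w0 wM] := detM; exists w => // j jj1.
move: wM; rewrite mulmxA mul_rV_lin1 /= => /rowP/(_ j).
by rewrite mul_mx_diag !mxE jj1 mulr1.
Qed.

(* p1 + t p2 at t = |z|^2 is a quarter of the Laplacian of psi(|z|^2).  The
   kernel vector is tangent to the leaf and moves only the coordinates z_j1 and w,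
   in which the test function is strictly subharmonic. *)
Lemma no_interior_max (T : set E) (j1 : 'I_m) (c x : E)
    (psi : option 'I_m -> R -> R) (p1 p2 : option 'I_m -> R) :
  laminated T -> T x ->
  (forall k, jet2 (psi k) (coord_dist c k x) (p1 k) (p2 k)) ->
  (forall k, k \in [:: None; Some j1] -> 0 < p1 k + coord_dist c k x * p2 k) ->
  ~ (\forall x' \near x, T x' ->
      \sum_k psi k (coord_dist c k x') <= \sum_k psi k (coord_dist c k x)).
Proof.
move=> lT Tx jpsi pos loc_max.
have [G [y [hG hy Gy]]] := lT x Tx; have [sG TG /(_ y hy)[A [injA dA]]] := hG.
have [w w0 Aw] := kernel_vector A j1.
pose v := real_of_vec w.
have vE : vec_of_real v = w by exact: real_of_vecK.
set u := real_of_Cn (A (vec_of_real v)).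
have := @levi_max R m T G y v A (fun k => cre k c) (fun k => cim k c) psi p1 p2 hG hy (dA v).
rewrite Gy -/u => /(_ jpsi) lev.
have {lev} : \sum_k (p1 k + coord_dist c k x * p2 k) * (cre k u ^+ 2 + cim k u ^+ 2) <= 0.
  apply: lev.
  have cG : {for y, continuous G} by exact: smooth_continuous sG hy.
  have := cG; rewrite /prop_for /continuous_at Gy => /(_ _ loc_max) h1.
  have {}h1 : \forall y' \near y, T (G y') -> \sum_k psi k (coord_dist c k (G y')) <=
    \sum_k psi k (coord_dist c k x) by exact: h1.
  have h2 := open_nbhs_nbhs (conj (@open_polydisc_real R m) hy).
  have h3 := @filterI _ _ (nbhs_filter y) _ _ h1 h2.
  by apply: (@filterS _ _ (nbhs_filter y)) h3 => y' [k1 k2]; exact: k1 (TG _ k2).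
have u0 j : j != j1 -> cre (Some j) u = 0 /\ cim (Some j) u = 0.
  by move=> jj1; rewrite /u vE /= !mxE Aw.
have term_ge0 k : 0 <= (p1 k + coord_dist c k x * p2 k) * (cre k u ^+ 2 + cim k u ^+ 2).
  have [kin|] := boolP (k \in [:: None; Some j1]).
    by apply: mulr_ge0; [exact/ltW/pos|rewrite addr_ge0 ?sqr_ge0].
  case: k => [j|]; last by rewrite inE eqxx.
  move=> jj1.
  have jn : j != j1 by apply: contra jj1 => /eqP->; rewrite !inE eqxx orbT.
  have [-> ->] := u0 j jn.
  by rewrite expr0n addr0 mulr0.
move=> sum_le0.
(* The sum is both nonpositive and made of nonnegative terms; the strictly positive coefficients at
   w and z_j1 then force u = 0, against the injectivity of A. *)
have sum0 : \sum_k (p1 k + coord_dist c k x * p2 k) * (cre k u ^+ 2 + cim k u ^+ 2) = 0.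
  by apply/eqP; rewrite eq_le sum_le0 sumr_ge0.
have cu0 k : k \in [:: None; Some j1] -> cre k u = 0 /\ cim k u = 0.
  move=> kin; have := sum0; move/eqP; rewrite psumr_eq0 // => /allP/(_ k).
  rewrite mem_index_enum => /(_ isT) /= /eqP/eqP.
  rewrite mulf_eq0 gt_eqF ?pos //= paddr_eq0 ?sqr_ge0 // !sqrf_eq0.
  by move=> /andP[/eqP-> /eqP->].
have uz : u = 0.
  have h k : cre k u = 0 /\ cim k u = 0.
    case: k => [j|]; last by apply: cu0; rewrite inE eqxx.
    by have [->|/u0 //] := eqVneq j j1; apply: cu0; rewrite !inE eqxx orbT.
  case: (u) h => [[u1 u2] [u3 u4]] h.
  congr ((_, _), (_, _)).
  - by apply/rowP => j; rewrite mxE; have [] := h (Some j).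
  - by apply/rowP => j; rewrite mxE; have [] := h (Some j).
  - by have [] := h None.
  - by have [] := h None.
have : A w = 0.
  rewrite -vE -(real_of_CnK (A _)) -/u uz.
  apply: injective_projections; first by apply/rowP => j; rewrite !mxE.
  by [].
by move=> /injA /eqP; rewrite (negbTE w0).
Qed.

Lemma compact_coord (A : set E) (c : E) (B : R) : closed A ->
  (forall x k, A x -> coord_dist c k x <= B) -> compact A.
Proof.
move=> cA AB.
(* The sum dominates every coordinate of c at once, and t^2 <= B gives |t| <= B + 1 without a square
   root. *)
pose M := \sum_k (`|cre k c| + `|cim k c|) + (B + 1).
have box_le x k : A x -> `|cre k x| <= M /\ `|cim k x| <= M.
  move=> /(AB _ k); rewrite /coord_dist /sqdist.
  have : `|cre k c| + `|cim k c| <= \sum_k (`|cre k c| + `|cim k c|).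
    by rewrite (bigD1 k) //= lerDl sumr_ge0 // => i _; rewrite addr_ge0.
  rewrite /M; move: (\sum_k _) => s hs h.
  have sq_le (t : R) : t ^+ 2 <= B -> `|t| <= B + 1.
    move=> tB; rewrite ler_norml; have := sqr_ge0 (t + 1); have := sqr_ge0 (t - 1).
    rewrite sqrrB1 sqrrD1 => ? ?; apply/andP; split; nra.
  have h1 : `|cre k x - cre k c| <= B + 1.
    by apply: sq_le; apply: le_trans h; rewrite lerDl sqr_ge0.
  have h2 : `|cim k x - cim k c| <= B + 1.
    by apply: sq_le; apply: le_trans h; rewrite lerDr sqr_ge0.
  have := ler_normD (cre k x - cre k c) (cre k c); rewrite subrK.
  have := ler_normD (cim k x - cim k c) (cim k c); rewrite subrK.
  have := normr_ge0 (cre k c); have := normr_ge0 (cim k c).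
  by move=> ? ? ? ?; split; lra.
have cI := @segment_compact R (- M) M.
have cV : compact [set v : 'rV[R]_m | forall j, `[- M, M]%classic (v 0 j)].
  exact: (@rV_compact _ _ (fun=> `[- M, M]%classic)).
have cE := compact_setX (compact_setX cV cV) (compact_setX cI cI).
apply: subclosed_compact cA cE _ => x Ax.
have h k := box_le x k Ax.
by split; split => /= [|]; rewrite /= ?in_itv /= -?ler_norml;
 try (move=> j; rewrite in_itv /= -ler_norml);
 first [by have [] := h (Some j)|by have [] := h None].
Qed.

End InteriorMaximum.

(** * Semicontinuity of the fibers, and jets of elementary functions *)

Section UpperSemicontinuity.
Variables (R : realType) (m : nat).
Local Notation V := ('rV[R]_m * 'rV[R]_m)%type.
Local Notation E := (V * (R * R))%type.
Implicit Types (T : set E) (c x : E).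

Lemma closed_sublevel c k (b : R) : closed [set x | coord_dist c k x <= b].
Proof.
exact: (preimage_closed (fun x _ => @coord_dist_continuous R m c k x) (@closed_le R b)).
Qed.

Lemma closed_superlevel c k (b : R) : closed [set x | b <= coord_dist c k x].
Proof.
exact: (preimage_closed (fun x _ => @coord_dist_continuous R m c k x) (@closed_ge R b)).
Qed.

Lemma closed_forall (J : Type) (T : topologicalType) (P : J -> T -> Prop) :
  (forall i, closed [set x | P i x]) -> closed [set x | forall i, P i x].
Proof.
move=> cP; rewrite (_ : mkset _ = \bigcap_(i in setT) [set x | P i x]).
  exact: closed_bigI.
by apply/seteqP; split=> x h i; [move=> _; exact: h|exact: h i I].
Qed.

Lemma continuous_bigsum (T : topologicalType) (J : Type) (r : seq J) (P : pred J)
    (f : J -> T -> R) (t : T) : (forall j, {for t, continuous (f j)}) ->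
  {for t, continuous (fun z : T => \sum_(j <- r | P j) f j z)}.
Proof.
move=> cf; rewrite /prop_for /continuous_at; elim: r => [|j r ih].
  rewrite big_nil; under [fun z => _]eq_fun do rewrite big_nil.
  exact: cvg_cst.
rewrite big_cons; under [fun z => _]eq_fun do rewrite big_cons.
by case: (P j) => //; apply: cvgD; [exact: cf|exact: ih].
Qed.

(** On the compact piece K the function f vanishes only at points over the base of c at squared
    distance at most M, and there are none; its positive minimum gives the uniform gap. An empty
    fiber over the base of c is allowed. *)
Lemma upper_semicontinuity T c (M B : R) : closed T ->
  (forall x, T x -> coord_dist c None x <= B) ->
  (forall x, T x -> (forall j, coord_dist c (Some j) x = 0) -> M < coord_dist c None x) ->
  exists r s : R, [/\ 0 < r, M < s & forall x, T x ->
    (forall j, coord_dist c (Some j) x <= r) -> s <= coord_dist c None x].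
Proof.
move=> cT TB above.
pose K := T `&` [set x | forall j : 'I_m, coord_dist c (Some j) x <= 1].
have cK : compact K.
  apply: (@compact_coord _ _ _ c (Num.max B 1)).
    by apply: closedI => //; apply: closed_forall => j; exact: closed_sublevel.
  by move=> x [j|] [Tx x1]; rewrite le_max ?x1 ?orbT // TB.
pose h x := coord_dist c None x - M.
pose f x := \sum_j coord_dist c (Some j) x + (`|h x| + h x).
have ch : continuous h.
  by move=> x; apply: cvgB; [exact: coord_dist_continuous|exact: cvg_cst].
have cf : continuous f.
  move=> x; apply: cvgD.
    by apply: continuous_bigsum => j; exact: coord_dist_continuous.
  by apply: cvgD; [apply: cvg_norm; exact: ch|exact: ch].
have h_ge0 x : 0 <= `|h x| + h x by have := ler_norm (- h x); rewrite normrN; lra.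
have sum_ge0 x : 0 <= \sum_j coord_dist c (Some j) x.
  by apply: sumr_ge0 => j _; exact: coord_dist_ge0.
have [[x0 Kx0]|K0] := pselect (K !=set0); last first.
  exists 1, (M + 1); split; rewrite ?ltrDl // => x Tx x1.
  by case: K0; exists x.
have [x1 Kx1 min1] := compact_EVT_min (ex_intro _ x0 Kx0) cK (continuous_subspaceT cf).
have fx1 : 0 < f x1.
  rewrite lt_def addr_ge0 // andbT; apply/negP => /eqP fx1.
  have := sum_ge0 x1; have := h_ge0 x1 => h1 h2.
  have s0 : \sum_j coord_dist c (Some j) x1 == 0 by move: fx1; rewrite /f; lra.
  have h0 : `|h x1| + h x1 = 0 by move: fx1; rewrite /f; lra.
  have [Tx1 _] := set_mem Kx1.
  have : M < coord_dist c None x1.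
    apply: above => // j; apply/eqP; move: s0; rewrite psumr_eq0 => [|i _]; last exact: coord_dist_ge0.
    by move=> /allP/(_ j); rewrite mem_index_enum => /(_ isT).
  by rewrite -subr_gt0 -/(h x1) => hp; move: h0; rewrite gtr0_norm //; lra.
(* The bound 1 keeps x in K, and m r <= f x1 / 2 leaves |h| + h >= f x1 / 2, hence h >= f x1 / 4,
   which is the gap s - M. *)
pose r := Num.min 1 (f x1 / (2 * (m%:R + 1))).
have m1 : 0 < (m%:R + 1 : R) by rewrite ltr_wpDl.
have r0 : 0 < r by rewrite lt_min ltr01 divr_gt0 // mulr_gt0.
exists r, (M + f x1 / 4); split => //; first by rewrite ltrDl divr_gt0.
move=> x Tx xr.
have Kx : x \in K by rewrite inE; split => // j; apply: le_trans (xr j) _; rewrite ge_min lexx.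
have := min1 x Kx; rewrite {2}/f.
have : \sum_j coord_dist c (Some j) x <= \sum_(j < m) r by apply: ler_sum.
rewrite sumr_const card_ord -mulr_natr.
have : r * (m%:R + 1) <= f x1 / 2.
  rewrite -ler_pdivlMr // -mulrA -invfM.
  by rewrite /r ge_min lexx orbT.
rewrite mulrDr mulr1 => h1 h2 h3.
have h4 : f x1 / 2 <= `|h x| + h x by lra.
have [hx|hx] := lerP (h x) 0; first by move: h4; rewrite ler0_norm //; lra.
by move: h4; rewrite gtr0_norm // /h; lra.
Qed.

Lemma jet2_linear (a x : R) : jet2 (fun t => a * t) x a 0.
Proof.
exists (cst a); split; [|by []|exact: is_derive_cst].
near=> s.
have := is_deriveZ a (is_derive_id s (1 : R)).
by rewrite [a *: 1]mulr1.
Unshelve. all: by end_near. Qed.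

Lemma is_derive_invr (t : R) : t != 0 -> is_derive t (1 : R) (fun t => t^-1) (- t ^- 2).
Proof.
move=> t0; have := @is_deriveV _ id t 1 1 t0 (is_derive_id _ _).
by rewrite [_ *: 1]mulr1.
Qed.

Lemma jet2_inv (x : R) : 0 < x -> jet2 (fun t => t^-1) x (- x ^- 2) (2 * x ^- 3).
Proof.
move=> x0.
exists (fun t => - t ^- 2); split => //.
  near=> t; apply: is_derive_invr; rewrite gt_eqF //.
  by near: t; exact: lt_nbhsr.
have xn : x ^+ 2 != 0 by rewrite expf_neq0 // gt_eqF.
have dsq : is_derive x (1 : R) (fun t : R => t ^+ 2) (2 * x).
  apply: (is_derive_eq (@is_deriveM R R id id x 1 1 1 (is_derive_id _ _) (is_derive_id _ _))).
  by rewrite /GRing.scale /=; ring.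
have := is_deriveN (@is_deriveV _ (fun t : R => t ^+ 2) x (2 * x) 1 xn dsq).
rewrite (_ : - (- (x ^+ 2) ^- 2 *: (2 * x)) = 2 * x ^- 3); first exact.
by rewrite /GRing.scale /=; field; rewrite gt_eqF.
Unshelve. all: by end_near. Qed.

Lemma jet2_ln (x : R) : 0 < x -> jet2 (@ln R) x x^-1 (- x ^- 2).
Proof.
move=> x0; exists (fun t => t^-1); split => //.
  near=> t; apply: is_derive1_ln; near: t; exact: lt_nbhsr.
by apply: is_derive_invr; rewrite gt_eqF.
Unshelve. all: by end_near. Qed.

End UpperSemicontinuity.

(** * The comparison function and Liouville's theorem in one coordinate *)

Section Barrier.
Variables (R : realType) (m : nat).
Local Notation V := ('rV[R]_m * 'rV[R]_m)%type.
Local Notation E := (V * (R * R))%type.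
Implicit Types (T : set E) (c x : E).

Definition barrier (t : R) : R := t^-1 + (-1) * ln t.

Lemma barrier_le (r t : R) : 0 < r -> r <= t -> barrier t <= barrier r.
Proof.
move=> r0 rt; have t0 := lt_le_trans r0 rt; apply: lerD.
  by rewrite lef_pV2.
by rewrite !mulN1r lerN2 ler_ln.
Qed.

(* On the slice through c in the direction z_j1, the sum of these functions is
   1/|w - a|^2 - e ln|z_j1|^2, the usual comparison function of Liouville's
   theorem in the plane, made strict by e/|z_j1|^2; the terms - K |z_j|^2 confine
   the maximum to a neighbourhood of that slice. *)
Definition test_fun (j1 : 'I_m) (e K : R) (k : option 'I_m) (t : R) : R :=
  if k == None then t^-1
  else if k == Some j1 then e * barrier t else (- K) * t.

Definition test_fun1 (j1 : 'I_m) (e K : R) (k : option 'I_m) (t : R) : R :=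
  if k == None then - t ^- 2
  else if k == Some j1 then e * (- t ^- 2 + (-1) * t^-1) else - K.

Definition test_fun2 (j1 : 'I_m) (e K : R) (k : option 'I_m) (t : R) : R :=
  if k == None then 2 * t ^- 3
  else if k == Some j1 then e * (2 * t ^- 3 + (-1) * (- t ^- 2)) else 0.

Lemma jet2_scale (a t b d : R) (f : R -> R) :
  jet2 f t b d -> jet2 (fun t => a * f t) t (a * b) (a * d).
Proof.
move=> jf; apply: jet2_eq (jet2_comp jf (jet2_linear a (f t))) _ _ => //.
by rewrite mul0r add0r.
Qed.

Lemma jet2_test_fun j1 e K k (t : R) : (k \in [:: None; Some j1] -> 0 < t) ->
  jet2 (test_fun j1 e K k) t (test_fun1 j1 e K k t) (test_fun2 j1 e K k t).
Proof.
rewrite /test_fun /test_fun1 /test_fun2.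
have [-> t0|kN] := eqVneq k None; first by apply: jet2_inv; apply: t0; rewrite inE eqxx.
have [-> t0|k1 _] := eqVneq k (Some j1); last exact: jet2_linear.
have {}t0 : 0 < t by apply: t0; rewrite !inE eqxx orbT.
exact: jet2_scale (jet2D (jet2_inv t0) (jet2_scale (-1) (jet2_ln t0))).
Qed.

Lemma test_fun_subharmonic j1 (e K : R) k (t : R) : 0 < e -> 0 < t ->
  k \in [:: None; Some j1] -> 0 < test_fun1 j1 e K k t + t * test_fun2 j1 e K k t.
Proof.
move=> e0 t0; rewrite !inE /test_fun1 /test_fun2 => /orP[/eqP->|/eqP->] /=.
  rewrite (_ : _ + _ = t ^- 2); first by rewrite invr_gt0 exprn_gt0.
  by field; rewrite gt_eqF.
rewrite eqxx (_ : _ + _ = e * t ^- 2); first by rewrite mulr_gt0 // invr_gt0 exprn_gt0.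
by field; rewrite gt_eqF.
Qed.

Lemma test_fun_sum j1 e K c x :
  \sum_k test_fun j1 e K k (coord_dist c k x) =
  (coord_dist c None x)^-1 + (e * barrier (coord_dist c (Some j1) x) +
   \sum_(k | (k != None) && (k != Some j1)) (- K) * coord_dist c k x).
Proof.
rewrite (bigD1 None) //= (bigD1 (Some j1)) //=; congr (_ + (_ + _)).
  by rewrite /test_fun eqxx.
by apply: eq_bigr => k /andP[kN k1]; rewrite /test_fun (negbTE kN) (negbTE k1).
Qed.

(** If the fiber over the base of c stays farther than M, the test function is maximized over the
    part of T where r <= |z_j1|^2 <= Y and |z_j|^2 <= r for the other j, all relative to c. Its
    value at x exceeds its values on every face of this box, so the maximum is interior, against
    [no_interior_max]. *)
Lemma liouville T c x (B d : R) (j1 : 'I_m) : closed T -> laminated T ->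
  (forall x, T x -> coord_dist c None x <= B) ->
  0 < d -> (forall x, T x -> d <= coord_dist c None x) ->
  T x -> (forall j, j != j1 -> coord_dist c (Some j) x = 0) ->
  exists x', [/\ T x', forall j, coord_dist c (Some j) x' = 0 &
    coord_dist c None x' <= coord_dist c None x].
Proof.
move=> cT lT TB d0 Td Tx xj; apply: contrapT => none.
set M := coord_dist c None x in none.
have above y : T y -> (forall j, coord_dist c (Some j) y = 0) -> M < coord_dist c None y.
  by move=> Ty yj; rewrite ltNge; apply/negP => yM; apply: none; exists y.
have [r [s [r0 Ms gap]]] := upper_semicontinuity cT TB above.
set X := coord_dist c (Some j1) x.
have rX : r < X.
  rewrite ltNge; apply/negP => Xr; suff : s <= M by rewrite leNgt Ms.
  apply: gap => // j; have [->//|/xj ->] := eqVneq j j1; exact: ltW.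
have M0 : 0 < M by apply: lt_le_trans d0 (Td _ Tx).
have s0 : 0 < s by apply: lt_trans M0 Ms.
have sM : s^-1 < M^-1 by rewrite ltf_pV2.
have dM : M^-1 <= d^-1 by rewrite lef_pV2 // Td.
have X0 : 0 < X by apply: lt_trans r0 rX.
have bX : barrier X <= barrier r by apply: barrier_le => //; exact: ltW.
pose D := barrier r - barrier X.
have D0 : 0 <= D by rewrite subr_ge0.
(* Inner face |z_j1|^2 = r: the barrier gains e * D over its value at x, which has to stay below the
   loss M^-1 - s^-1 that the gap guarantees. *)
pose e := (M^-1 - s^-1) / (2 * (D + 1)).
have D1 : 0 < D + 1 by rewrite ltr_wpDl.
have e0 : 0 < e by rewrite divr_gt0 ?subr_gt0 // mulr_gt0.
have eD : e * D < M^-1 - s^-1.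
  have -> : e * D = (M^-1 - s^-1) * (D / (2 * (D + 1))) by rewrite /e; ring.
  rewrite gtr_pMr ?subr_gt0 // ltr_pdivrMr ?mulr_gt0 // mul1r; lra.
have di : 0 < d^-1 by rewrite invr_gt0.
(* Side faces |z_j|^2 = r: the penalty K r cancels the largest possible value d^-1 of 1/|w - a|^2
   and the largest gain e * D of the barrier. *)
pose K := (d^-1 + e * D) / r.
have eD0 : 0 <= e * D by rewrite mulr_ge0 // ltW.
have K0 : 0 < K by rewrite divr_gt0 // ltr_pwDl.
have Kr : K * r = d^-1 + e * D by rewrite /K divfK // gt_eqF.
(* Outer face: ln Y >= L makes e * barrier Y at most e * barrier X - d^-1, which absorbs the bound
   d^-1 on 1/|w - a|^2. The summands X and r of Y only ensure X < Y and r < Y. *)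
pose L := d^-1 / e + r^-1 - barrier X.
pose Y := expR (`|L|) + X + r.
have eL : 0 < expR (`|L|) by exact: expR_gt0.
have rY : r < Y by rewrite /Y; lra.
have XY : X < Y by rewrite /Y; lra.
have Y0 : 0 < Y by apply: lt_trans r0 rY.
have bY : d^-1 + e * barrier Y < M^-1 + e * barrier X.
  have h1 : Y^-1 <= r^-1 by rewrite lef_pV2 // ltW.
  have h2 : L <= ln Y.
    apply: le_trans (ler_norm L) _; rewrite -[leLHS]expRK.
    by rewrite ler_ln ?posrE // /Y; lra.
  have h3 : barrier Y <= barrier X - d^-1 / e.
    by rewrite {1}/barrier; move: h2; rewrite /L; lra.
  have : e * barrier Y <= e * (barrier X - d^-1 / e) by rewrite ler_pM2l.
  have -> : e * (barrier X - d^-1 / e) = e * barrier X - d^-1.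
    by field; rewrite ?gt_eqF.
  have : 0 < M^-1 by rewrite invr_gt0.
  lra.
pose phi y := \sum_k test_fun j1 e K k (coord_dist c k y).
pose box y := [/\ r <= coord_dist c (Some j1) y, coord_dist c (Some j1) y <= Y &
  forall j, j != j1 -> coord_dist c (Some j) y <= r].
pose Q := T `&` [set y | box y].
have cQ : closed Q.
  apply: closedI => //.
  have -> : [set y | box y] = [set y | r <= coord_dist c (Some j1) y] `&`
      ([set y | coord_dist c (Some j1) y <= Y] `&`
       [set y | forall j : {j | j != j1}, coord_dist c (Some (val j)) y <= r]).
    apply/seteqP; split=> y.
      by move=> [h1 h2 h3]; split=> //; split=> // -[j jj]; exact: h3.
    by move=> [h1 [h2 h3]]; split=> // j jj; exact: (h3 (exist _ j jj)).
  apply: closedI; first exact: closed_superlevel.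
  apply: closedI; first exact: closed_sublevel.
  by apply: closed_forall => j; exact: closed_sublevel.
have compQ : compact Q.
  apply: (@compact_coord _ _ Q c (Num.max B (Num.max Y r))) => //.
  move=> y [j|] [Ty [_ yY yr]]; last by rewrite le_max TB.
  have [->|jj] := eqVneq j j1; rewrite !le_max; first by rewrite yY !orbT.
  by rewrite (yr j jj) !orbT.
have Qx : Q x.
  split=> //; split; [exact: ltW|exact: ltW|].
  by move=> j jj; rewrite (xj j jj) ltW.
have posN y : T y -> 0 < coord_dist c None y by move=> /Td; exact: lt_le_trans.
have cphi y : Q y -> {for y, continuous phi}.
  move=> [Ty [ry _ _]].
  have pos k : k \in [:: None; Some j1] -> 0 < coord_dist c k y.
    rewrite !inE => /orP[/eqP->|/eqP->]; first exact: posN.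
    exact: lt_le_trans ry.
  have ck k : {for coord_dist c k y, continuous (test_fun j1 e K k)}.
    have [g [/nbhs_singleton [dg _] _ _]] := jet2_test_fun e K (pos k).
    by apply: differentiable_continuous; apply/derivable1_diffP.
  apply: continuous_bigsum => k.
  exact: (continuous_comp (@coord_dist_continuous R m c k y) (ck k)).
have [y Qy ymax] : exists2 y, y \in Q & forall z, z \in Q -> phi z <= phi y.
  apply: compact_EVT_max => //; first by exists x.
  by apply: continuous_in_subspaceT => z /set_mem; exact: cphi.
have [Ty [ry yY yr]] := set_mem Qy.
have phix : M^-1 + e * barrier X <= phi y.
  apply: le_trans (ymax x (mem_set Qx)); rewrite /phi test_fun_sum -/M -/X.
  rewrite big1 ?addr0 // => -[j|] /andP[// _ jj].
  by rewrite xj ?mulr0 //; apply: contra jj => /eqP->.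
have rest_le0 y' : \sum_(k | (k != None) && (k != Some j1)) (- K) * coord_dist c k y' <= 0.
  by apply: sumr_le0 => k _; rewrite mulNr oppr_le0 mulr_ge0 ?coord_dist_ge0 // ltW.
have phiy := test_fun_sum j1 e K c y; rewrite -/(phi y) in phiy.
have byr : e * barrier (coord_dist c (Some j1) y) <= e * barrier r.
  by rewrite ler_pM2l // barrier_le.
have Ny : (coord_dist c None y)^-1 <= d^-1 by rewrite lef_pV2 ?posrE ?posN ?Td.
have eDE : e * D = e * barrier r - e * barrier X by rewrite mulrBr.
have y1 : r < coord_dist c (Some j1) y.
  rewrite lt_neqAle ry andbT; apply/negP => /eqP rE.
  have : s <= coord_dist c None y.
    by apply: gap => // j; have [->|/yr//] := eqVneq j j1; rewrite -rE.
  rewrite -lef_pV2 ?posrE ?posN // => h.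
  by have := rest_le0 y; lra.
have y2 : coord_dist c (Some j1) y < Y.
  rewrite lt_neqAle yY andbT; apply/negP => /eqP YE.
  by have := rest_le0 y; rewrite YE in phiy; lra.
have y3 j : j != j1 -> coord_dist c (Some j) y < r.
  move=> jj; rewrite lt_neqAle yr // andbT; apply/negP => /eqP jE.
  have : \sum_(k | (k != None) && (k != Some j1)) (- K) * coord_dist c k y <= - (K * r).
    rewrite (bigD1 (Some j)) /=; last by apply: contra jj => /eqP[->].
    rewrite jE mulNr gerDl; apply: sumr_le0 => k _.
    by rewrite mulNr oppr_le0 mulr_ge0 ?coord_dist_ge0 // ltW.
  have : 0 < M^-1 by rewrite invr_gt0.
  lra.
apply: (@no_interior_max R m T j1 c y (test_fun j1 e K)
  (fun k => test_fun1 j1 e K k (coord_dist c k y))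
  (fun k => test_fun2 j1 e K k (coord_dist c k y)) lT Ty).
- move=> k; apply: jet2_test_fun; rewrite !inE => /orP[/eqP->|/eqP->]; first exact: posN.
  exact: lt_trans y1.
- move=> k kin; apply: test_fun_subharmonic => //; move: kin.
  rewrite !inE => /orP[/eqP->|/eqP->]; first exact: posN.
  exact: lt_trans y1.
have n1 : \forall z \near y, r < coord_dist c (Some j1) z.
  by apply: (cvgr_gt _ (@coord_dist_continuous R m c (Some j1) y)).
have n2 : \forall z \near y, coord_dist c (Some j1) z < Y.
  by apply: (cvgr_lt _ (@coord_dist_continuous R m c (Some j1) y)).
have n3 : \forall z \near y, forall j, j != j1 -> coord_dist c (Some j) z < r.
  apply: (@filter_forall _ _ (fun j (z : E) => j != j1 -> coord_dist c (Some j) z < r)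
    (nbhs y) (nbhs_filter y)) => j.
  have [->|jj] := eqVneq j j1; first by near=> z.
  have : \forall z \near y, coord_dist c (Some j) z < r.
    by apply: (cvgr_lt _ (@coord_dist_continuous R m c (Some j) y)); exact: y3.
  by apply: filterS => z h _.
near=> z => Tz; apply: ymax; apply: mem_set; split=> //; split.
- by apply: ltW; near: z.
- by apply: ltW; near: z.
- by move=> j jj; apply: ltW; move: j jj; near: z.
Unshelve. all: by end_near. Qed.

End Barrier.

(** * Hyperplanes inside the hypersurface *)

Lemma sqr_lt_norm (R : realDomainType) (t r : R) : 0 < r -> t ^+ 2 < r ^+ 2 -> `|t| < r.
Proof.
by move=> r0 h; rewrite -(gtr0_norm r0) -ltr_sqr ?nnegrE // !real_normK ?num_real.
Qed.

(** Balls in R * R are for the maximum norm while nearness to a is Euclidean. Each coordinate of x -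
    a is below e / 4, so |u - a|^2 <= 2 (e / 4)^2 < (e / 2)^2, and e / 2 + e / 8 < e. *)
Lemma nearest_triangle (R : realFieldType) (e w1 w2 u1 u2 a1 a2 x1 x2 : R) : 0 < e ->
  `|w1 - x1| < e / 8 -> `|w2 - x2| < e / 8 -> `|w1 - a1| < e / 8 -> `|w2 - a2| < e / 8 ->
  (u1 - a1) ^+ 2 + (u2 - a2) ^+ 2 <= (x1 - a1) ^+ 2 + (x2 - a2) ^+ 2 ->
  `|w1 - u1| < e /\ `|w2 - u2| < e.
Proof.
move=> e0; rewrite !ltr_norml => /andP[? ?] /andP[? ?] /andP[? ?] /andP[? ?] h.
have e4 : 0 < e / 4 by rewrite divr_gt0.
have sq (t : R) : - (e / 4) < t -> t < e / 4 -> t ^+ 2 <= (e / 4) ^+ 2 by nra.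
have b1 : (x1 - a1) ^+ 2 <= (e / 4) ^+ 2 by apply: sq; lra.
have b2 : (x2 - a2) ^+ 2 <= (e / 4) ^+ 2 by apply: sq; lra.
have e2 : (e / 2) ^+ 2 = 4 * (e / 4) ^+ 2 by field.
have e4sq := exprn_gt0 2 e4.
have k1 : `|u1 - a1| < e / 2.
  by apply: sqr_lt_norm; [rewrite divr_gt0|have := sqr_ge0 (u2 - a2); lra].
have k2 : `|u2 - a2| < e / 2.
  by apply: sqr_lt_norm; [rewrite divr_gt0|have := sqr_ge0 (u1 - a1); lra].
move: k1 k2; rewrite !ltr_norml => /andP[? ?] /andP[? ?].
by split; apply/andP; split; lra.
Qed.

Section Fibers.
Variables (R : realType) (m : nat).
Local Notation V := ('rV[R]_m * 'rV[R]_m)%type.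
Local Notation E := (V * (R * R))%type.
Implicit Types (T : set E) (c x : E).

Lemma coord_dist_eq0 c j x : coord_dist c (Some j) x = 0 <->
  x.1.1 0 j = c.1.1 0 j /\ x.1.2 0 j = c.1.2 0 j.
Proof.
rewrite /coord_dist /sqdist /=; split=> [/eqP|[-> ->]]; last by rewrite !subrr expr0n addr0.
by rewrite paddr_eq0 ?sqr_ge0 // !sqrf_eq0 !subr_eq0 => /andP[/eqP-> /eqP->].
Qed.

(** The coordinates of the base are moved to those of z one at a time, without ever increasing the
    distance to a. *)
Lemma liouville_all T (a : R * R) x (z : V) (B d : R) : closed T -> laminated T ->
  (forall x, T x -> coord_dist (z, a) None x <= B) ->
  0 < d -> (forall x, T x -> d <= coord_dist (z, a) None x) -> T x ->
  exists2 w, T (z, w) & coord_dist (z, a) None (z, w) <= coord_dist (z, a) None x.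
Proof.
move=> cT lT TB d0 Td Tx.
have [x' [Tx' x'z x'a]] : exists x', [/\ T x',
    forall j, j \in index_enum 'I_m -> x'.1.1 0 j = z.1 0 j /\ x'.1.2 0 j = z.2 0 j &
    coord_dist (z, a) None x' <= coord_dist (z, a) None x].
  elim: (index_enum _) => [|j s [y [Ty yz ya]]]; first by exists x.
  (* The new base takes its j-th coordinate from z and the others from the point y reached so
     far. *)
  pose z' : V := (\row_i (if i == j then z.1 0 i else y.1.1 0 i),
                  \row_i (if i == j then z.2 0 i else y.1.2 0 i)).
  have yz' i : i != j -> coord_dist (z', a) (Some i) y = 0.
    by move=> ij; apply/coord_dist_eq0; rewrite /= !mxE (negbTE ij).
  have [y' [Ty' y'z y'a]] := @liouville R m T (z', a) y B d j cT lT TB d0 Td Ty yz'.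
  exists y'; split=> // [i|]; last exact: le_trans y'a ya.
  have := y'z i => /coord_dist_eq0 /=; rewrite !mxE in_cons => -[-> ->].
  by case: eqP => //= _ /yz.
have zE : x'.1 = z.
  case: x' x'z {Tx' x'a} => [[x1 x2] x3] /= h; case: z h {TB Td} => z1 z2 /= h.
  by congr pair; apply/rowP => j; have [] := h j (mem_index_enum j).
by exists x'.2; rewrite -zE -surjective_pairing.
Qed.

(** The closure is taken because projecting a closed set along the noncompact z-space need not give
    a closed set. *)
Definition fiber_union T : set (R * R) := closure (snd @` T).

Lemma closed_fiber_union T : closed (fiber_union T).
Proof. exact: closed_closure. Qed.

Lemma fiber_union_sub T x : T x -> fiber_union T x.2.
Proof. by move=> Tx; apply: subset_closure; exists x. Qed.

Definition frontier (B : set (R * R)) : set (R * R) := B `\` interior B.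

Lemma closed_frontier B : closed B -> closed (frontier B).
Proof. by move=> cB; apply: closedI => //; apply: open_closedC; exact: open_interior. Qed.

(* The distance from a point outside of the union of the fibers to a single fiber
   is the same for all fibers, hence tends to 0 as the point tends to w. *)
Lemma frontier_in_fibers T w z : closed T -> laminated T ->
  (forall x, T x -> x.2.1 ^+ 2 + x.2.2 ^+ 2 <= 1) ->
  frontier (fiber_union T) w -> T (z, w).
Proof.
move=> cT lT T1 [Bw nBw]; apply: (cT) => N /nbhs_ballP[e /= e0 HN].
have e8 : 0 < e / 8 by rewrite divr_gt0.
have [_ [[x Tx <-] wx]] := Bw _ (nbhsx_ballx w _ e8).
have [a [wa nBa]] : exists a, ball w (e / 8) a /\ ~ fiber_union T a.
  apply: contrapT => h; apply: nBw; apply/nbhs_ballP; exists (e / 8) => //= a wa.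
  by apply: contrapT => nBa; apply: h; exists a.
have [d /= d0 Hd] : exists2 d : R, 0 < d & forall y, T y -> ~ ball a d y.2.
  have : nbhs a (~` fiber_union T).
    by apply: open_nbhs_nbhs; split=> //; apply: closed_openC; exact: closed_fiber_union.
  move=> /nbhs_ballP[d /= d0 Hd]; exists d => // y Ty /Hd; apply.
  exact: fiber_union_sub.
have Td y : T y -> d ^+ 2 <= coord_dist (z, a) None y.
  move=> Ty; rewrite leNgt; apply/negP; rewrite /coord_dist /sqdist /= => h; apply: (Hd y Ty).
  split; rewrite /= -ball_normE /= distrC; apply: sqr_lt_norm => //; apply: le_lt_trans h.
    by rewrite lerDl sqr_ge0.
  by rewrite lerDr sqr_ge0.
have TB y : T y -> coord_dist (z, a) None y <= 2 + 2 * (a.1 ^+ 2 + a.2 ^+ 2).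
  have sq_le (p q r s : R) : p ^+ 2 + q ^+ 2 <= 1 ->
      (p - r) ^+ 2 + (q - s) ^+ 2 <= 2 + 2 * (r ^+ 2 + s ^+ 2).
    by have := sqr_ge0 (p + r); have := sqr_ge0 (q + s); nra.
  by move=> /T1; exact: sq_le.
have [w' Tw' w'a] := liouville_all cT lT TB (exprn_gt0 2 d0) Td Tx.
exists (z, w'); split=> //; apply: HN; split; first exact: ballxx.
have [wx1 wx2] := wx; have [wa1 wa2] := wa.
move: wx1 wx2 wa1 wa2; rewrite /= -!ball_normE /= => wx1 wx2 wa1 wa2.
have [h1 h2] := nearest_triangle e0 wx1 wx2 wa1 wa2 w'a.
change (`|w - w'| < e); rewrite prod_normE gt_max.
by apply/andP; split; [exact: h1|exact: h2].
Qed.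

End Fibers.

(** * Paths that avoid the frontier of a closed set *)

Section Segments.
Variables (R : realType) (W : normedModType R).

(** The parameters whose point lies in B form a nonempty, closed and relatively open subset of
    [0, 1], which is connected. *)
Lemma segment_stays (B : set W) p q : closed B -> B p ->
  (forall t : R, 0 <= t <= 1 -> B (p + t *: (q - p)) -> interior B (p + t *: (q - p))) ->
  B q.
Proof.
move=> cB Bp stay.
pose L := fun t : R => p + t *: (q - p).
have cL : continuous L by move=> t; exact: cvg_line.
have E : `[(0 : R), 1]%classic `&` L @^-1` B = `[(0 : R), 1]%classic.
  apply: (@segment_connected R 0 1).
  - exists 0; split; first by rewrite /= in_itv /= lexx ler01.
    by rewrite /L /preimage /= scale0r addr0.
  - exists (L @^-1` interior B); first by apply: open_comp => //; exact: open_interior.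
    apply/seteqP; split=> t [t01 Bt]; split=> //.
      by apply: stay => //; move: t01; rewrite /= in_itv.
    exact: interior_subset Bt.
  - exists (L @^-1` B) => //; apply: preimage_closed => // t _; exact: cL.
have : (`[(0 : R), 1]%classic `&` L @^-1` B) 1 by rewrite E /= in_itv /= ler01 lexx.
by move=> [_]; rewrite /L /preimage /= scale1r subrKC.
Qed.

(* The graph [r = 0] cuts the box in an upper and a lower side; each of them is
   joined to the interior point of B on the graph by a path that avoids the
   frontier of B. *)
Lemma box_fill (B : set W) (e f w0 : W) (d d' : R) (r : W -> R) (x0 y0 : R) :
  closed B ->
  let pt x y := w0 + (x *: f + y *: e) in
  (forall x y y', `|x| <= d' -> - d <= y -> y < y' -> y' <= d -> r (pt x y) < r (pt x y')) ->
  (forall x, `|x| <= d' -> 0 < r (pt x d)) ->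
  (forall x, `|x| <= d' -> r (pt x (- d)) < 0) ->
  (forall x y, `|x| <= d' -> - d <= y <= d -> B (pt x y) -> r (pt x y) != 0 ->
    interior B (pt x y)) ->
  `|x0| <= d' -> - d < y0 < d -> interior B (pt x0 y0) -> r (pt x0 y0) = 0 ->
  forall x y, `|x| <= d' -> - d < y < d -> B (pt x y).
Proof.
move=> cB pt mono top bot stay x0d y0d Bx0 rx0 x y xd yd.
have ptv a b s : pt a b + s *: e = pt a (b + s) by rewrite /pt -!addrA -scalerDl.
have pth a b s : pt a b + s *: f = pt (a + s) b.
  by rewrite /pt -addrA addrAC -scalerDl.
have dptv a b b' : pt a b' - pt a b = (b' - b) *: e.
  by rewrite /pt opprD addrACA subrr add0r opprD addrACA subrr add0r -scalerBl.
have dpth a a' b : pt a' b - pt a b = (a' - a) *: f.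
  by rewrite /pt opprD addrACA subrr add0r opprD addrACA subrr addr0 -scalerBl.
have mono_le a b b' : `|a| <= d' -> - d <= b -> b <= b' -> b' <= d -> r (pt a b) <= r (pt a b').
  move=> ad db; rewrite le_eqVlt => /orP[/eqP->//|bb'] b'd.
  exact/ltW/mono.
(* Monotonicity keeps r of one sign between two heights where it has that sign, so a vertical
   segment avoids the graph. *)
have vert a b b' : `|a| <= d' -> - d <= b <= d -> - d <= b' <= d ->
    (0 < r (pt a b) /\ 0 < r (pt a b')) \/ (r (pt a b) < 0 /\ r (pt a b') < 0) ->
    B (pt a b) -> B (pt a b').
  move=> ad /andP[b1 b2] /andP[b'1 b'2] sgn Bb; apply: (segment_stays cB Bb) => t /andP[t0 t1].
  have -> : pt a b + t *: (pt a b' - pt a b) = pt a (b + t * (b' - b)).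
    by rewrite dptv scalerA ptv.
  have h : - d <= b + t * (b' - b) <= d by apply/andP; split; nra.
  have /andP[h1 h2] := h.
  move=> Bt; apply: stay => //.
  case: sgn => [[p1 p2]|[p1 p2]]; [rewrite gt_eqF //|rewrite lt_eqF //];
    have [bb'|bb'] := lerP b b'.
  - by apply: lt_le_trans p1 _; apply: mono_le => //; nra.
  - by apply: lt_le_trans p2 _; apply: mono_le => //; nra.
  - by apply: le_lt_trans p2; apply: mono_le => //; nra.
  - by apply: le_lt_trans p1; apply: mono_le => //; nra.
have horiz b a a' : `|a| <= d' -> `|a'| <= d' -> - d <= b <= d ->
    (forall a, `|a| <= d' -> r (pt a b) != 0) -> B (pt a b) -> B (pt a' b).
  move=> ad a'd bd rn Ba; apply: (segment_stays cB Ba) => t /andP[t0 t1].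
  have -> : pt a b + t *: (pt a' b - pt a b) = pt (a + t * (a' - a)) b.
    by rewrite dpth scalerA pth.
  have h : `|a + t * (a' - a)| <= d'.
    move: ad a'd; rewrite !ler_norml => /andP[? ?] /andP[? ?]; apply/andP; split; nra.
  by move=> Bt; apply: stay => //; exact: rn.
have /andP[y0l y0r] := y0d; have /andP[yl yr] := yd.
have d0 : - d <= d by lra.
have near_pt (N : set W) a b : open N -> N (pt a b) ->
    exists2 h : R, 0 < h & forall s, `|s| <= h -> N (pt a (b + s)).
  move=> oN Nab; have /nbhs_ballP[h /= h0 Hh] := near_line e oN Nab.
  exists (h / 2); first by rewrite divr_gt0.
  move=> s sh; rewrite -ptv; apply: Hh; rewrite -ball_normE /= sub0r normrN.
  by apply: le_lt_trans sh _; rewrite ltr_pdivrMr // ltr_pMr // ltr1n.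
(* The path starts just above (x0, y0), still in the interior of B, rises to the top edge, follows
   it to abscissa x and descends to the target. *)
have up b : - d <= b <= d -> 0 < r (pt x b) -> B (pt x b).
  move=> bd rb; have [h h0 Bh] := near_pt _ _ _ (open_interior B) Bx0.
  pose s := Num.min h (d - y0).
  have s0 : 0 < s by rewrite lt_min h0 subr_gt0.
  have sh : s <= h by rewrite ge_min lexx.
  have sd : s <= d - y0 by rewrite ge_min lexx orbT.
  have B1 : B (pt x0 (y0 + s)) by apply: interior_subset; apply: Bh; rewrite gtr0_norm.
  have r1 : 0 < r (pt x0 (y0 + s)) by rewrite -rx0; apply: mono => //; lra.
  have B2 : B (pt x0 d).
    apply: vert B1 => //; [by apply/andP; split; lra|by rewrite d0 lexx|].
    by left; split=> //; exact: top.
  have B3 : B (pt x d).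
    apply: horiz B2 => //; first by rewrite d0 lexx.
    by move=> a ad; rewrite gt_eqF // top.
  apply: vert B3 => //; first by rewrite d0 lexx.
  by left; split=> //; exact: top.
have down b : - d <= b <= d -> r (pt x b) < 0 -> B (pt x b).
  move=> bd rb; have [h h0 Bh] := near_pt _ _ _ (open_interior B) Bx0.
  pose s := Num.min h (y0 + d).
  have s0 : 0 < s by rewrite lt_min h0 -[d]opprK subr_gt0.
  have sh : s <= h by rewrite ge_min lexx.
  have sd : s <= y0 + d by rewrite ge_min lexx orbT.
  have B1 : B (pt x0 (y0 - s)) by apply: interior_subset; apply: Bh; rewrite normrN gtr0_norm.
  have r1 : r (pt x0 (y0 - s)) < 0 by rewrite -rx0; apply: mono => //; lra.
  have B2 : B (pt x0 (- d)).
    apply: vert B1 => //; [by apply/andP; split; lra|by rewrite d0 lexx|].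
    by right; split=> //; exact: bot.
  have B3 : B (pt x (- d)).
    apply: horiz B2 => //; first by rewrite d0 lexx.
    by move=> a ad; rewrite lt_eqF // bot.
  apply: vert B3 => //; first by rewrite d0 lexx.
  by right; split=> //; exact: bot.
have [rxy|rxy|rxy] := ltrgtP (r (pt x y)) 0.
- by apply: down => //; rewrite !ltW.
- by apply: up => //; rewrite !ltW.
(* A point of the graph outside the closed set B would have a whole neighbourhood outside B, but the
   points just above it belong to B. *)
apply: contrapT => nB.
have [h h0 Bh] := near_pt _ _ _ (closed_openC cB) nB.
pose s := Num.min h (d - y).
have s0 : 0 < s by rewrite lt_min h0 subr_gt0.
have sh : s <= h by rewrite ge_min lexx.
have sd : s <= d - y by rewrite ge_min lexx orbT.
apply: (Bh s); first by rewrite gtr0_norm.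
apply: up; first by apply/andP; split; lra.
by rewrite -rxy; apply: mono => //; lra.
Qed.

End Segments.

(** * Fibers near a hyperplane contained in the hypersurface *)

Section LocalStructure.
Variables (R : realType) (m : nat).
Local Notation V := ('rV[R]_m * 'rV[R]_m)%type.
Local Notation E := (V * (R * R))%type.

Lemma continuous_near_gt (T : topologicalType) (f : T -> R) (x : T) a :
  {for x, continuous f} -> a < f x -> \forall y \near x, a < f y.
Proof. by move=> cf; exact: (cvgr_gt _ cf). Qed.

Lemma continuous_near_lt (T : topologicalType) (f : T -> R) (x : T) a :
  {for x, continuous f} -> f x < a -> \forall y \near x, f y < a.
Proof. by move=> cf; exact: (cvgr_lt _ cf). Qed.

Lemma ball_pair (V1 W1 : normedModType R) (p : V1 * W1) (r : R) z w :
  ball p.1 r z -> `|p.2 - w| < r -> ball p r (z, w).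
Proof.
by rewrite -!ball_normE /= prod_normE gt_max /= => -> ->.
Qed.

Lemma box_bound (A B d a b : R) : 0 <= A -> 0 <= B -> 0 < d ->
  a <= 3 * d * A -> b <= 3 * d * B -> a + b < 4 * (d * (A + B + 1)).
Proof.
move=> A0 B0 d0 aA bB; have := mulr_ge0 (ltW d0) A0; have := mulr_ge0 (ltW d0) B0.
by rewrite !mulrDr; lra.
Qed.

Lemma le_triple (d a : R) : 0 < d -> a <= d -> a <= 3 * d.
Proof. by lra. Qed.

Lemma norm_le_triple (d y y' c : R) : - d <= y -> y < y' -> y' <= d ->
  `|c| <= y' - y -> `|y + c| <= 3 * d.
Proof. by rewrite !ler_norml => ? ? ? /andP[? ?]; apply/andP; split; lra. Qed.

Lemma lt_double (a b : R) : 0 <= a -> 0 <= b -> a < 2 * (a + b + 1).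
Proof. by lra. Qed.

Lemma near_fst (T1 T2 : topologicalType) (p : T1 * T2) (Q : T1 -> Prop) :
  (\forall v \near p.1, Q v) -> \forall x \near p, Q x.1.
Proof. by move=> h; exact: (@fst_continuous T1 T2 p _ h). Qed.

Lemma near_snd (T1 T2 : topologicalType) (p : T1 * T2) (Q : T2 -> Prop) :
  (\forall v \near p.2, Q v) -> \forall x \near p, Q x.2.
Proof. by move=> h; exact: (@snd_continuous T1 T2 p _ h). Qed.

(** Additivity in the direction is not built into [smooth]: the increment from p + h u to p + h (u +
    v) is h times the derivative along v at a nearby point, and that derivative is continuous. *)
Lemma derive_dirD (W : normedModType R) (U : set W) (f : W -> R) p u v :
  open U -> U p -> smooth U f -> 'D_(u + v) f p = 'D_u f p + 'D_v f p.
Proof.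
move=> oU Up sf.
have cv : {for p, continuous (fun q => 'D_v f q)}.
  exact: smooth_continuous (smooth_derive v sf) Up.
have H1 : h^-1 *: (f (h *: u + p) - f p) @[h --> (0 : R)^'] --> 'D_u f p.
  exact: smooth_derivable sf Up.
have H2 : h^-1 *: (f (h *: (u + v) + p) - f (h *: u + p)) @[h --> (0 : R)^'] --> 'D_v f p.
  apply/(@cvgrPdist_lt _ _ _ _ _) => e e0.
  have h0 : nbhs p U by exact: open_nbhs_nbhs.
  have h1 := @cvgr_dist_lt _ _ _ _ (nbhs_filter p) _ _ cv _ e0.
  have /nbhs_ballP[d /= d0 Hd] := @filterI _ _ (nbhs_filter p) _ _ h0 h1.
  have M0 : 0 < `|u| + `|v| + 1 by rewrite ltr_wpDl ?addr_ge0.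
  near=> h.
  have hn0 : h != 0 by near: h; exact: nbhs_dnbhs_neq.
  have hd : `|h| < d / (`|u| + `|v| + 1).
    by near: h; apply: dnbhs0_lt; exact: divr_gt0.
  have inb c : `|c| <= `|h| -> ball p d (h *: u + p + c *: v).
    move=> ch; rewrite -ball_normE /=.
    rewrite (_ : p - _ = - (h *: u + c *: v)); last first.
      by rewrite [h *: u + p]addrC -addrA opprD addrA subrr add0r.
    rewrite normrN; apply: le_lt_trans (ler_normD _ _) _; rewrite !normrZ.
    move: hd; rewrite ltr_pdivlMr // => hd; apply: le_lt_trans hd.
    have h2 : `|c| * `|v| <= `|h| * `|v| by rewrite ler_wpM2r.
    by have := normr_ge0 h; rewrite !mulrDr; lra.
  have [|c ch] := @mvt_line _ _ f (h *: u + p) v h.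
    move=> t th; suff [Ut _] : (U `&` [set t | `|'D_v f p - 'D_v f t| < e]) (h *: u + p + t *: v).
      exact: smooth_derivable sf Ut.
    by apply: Hd; exact: inb.
  rewrite -addrA (addrC p) addrA -scalerDr => ->.
  rewrite [h^-1 *: _]mulrA mulVf // mul1r.
  have [_ +] := Hd _ (inb c ch); exact.
have H3 : h^-1 *: (f (h *: (u + v) + p) - f p) @[h --> (0 : R)^'] --> 'D_v f p + 'D_u f p.
  have -> : (fun h : R => h^-1 *: (f (h *: (u + v) + p) - f p)) =
    (fun h : R => h^-1 *: (f (h *: (u + v) + p) - f (h *: u + p))) \+
    (fun h : R => h^-1 *: (f (h *: u + p) - f p)).
    by apply/funext => h /=; rewrite -scalerDr addrA subrK.
  exact: cvgD H2 H1.
transitivity ('D_v f p + 'D_u f p); last exact: addrC.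
by rewrite {1}/derive; exact: (cvg_lim (@norm_hausdorff _ _) H3).
Unshelve. all: by end_near. Qed.

Lemma derive_dirN (W : normedModType R) (U : set W) (f : W -> R) p v :
  open U -> U p -> smooth U f -> 'D_(- v) f p = - 'D_v f p.
Proof.
move=> oU Up sf; apply/eqP; rewrite -addr_eq0 -(derive_dirD _ _ oU Up sf).
by rewrite addNr derive0.
Qed.

Definition hypersurface_real (S : set E) := forall p, S p ->
  exists U (rho : E -> R), [/\ open U, U p, smooth U rho,
    (forall x, U x -> (S x <-> rho x = 0)) & exists v, 'D_v rho p != 0].

(** As rho vanishes on the hyperplane through p, only the vertical component of a direction
    contributes. *)
Lemma derive_horizontal (S U : set E) (rho : E -> R) (p v : E) : open U -> U p -> smooth U rho ->
  (forall x, U x -> (S x <-> rho x = 0)) -> (forall z, S (z, p.2)) ->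
  'D_v rho p = 'D_(0, v.2) rho p.
Proof.
move=> oU Up sr SU Sp.
have -> : v = (v.1, 0) + (0, v.2).
  by apply: injective_projections; rewrite /= ?addr0 ?add0r.
rewrite (derive_dirD _ _ oU Up sr) /= add0r.
suff -> : 'D_(v.1, 0) rho p = 0 by rewrite add0r.
have d : 'D_(1 : R) (fun s : R => rho (p + s *: (v.1, 0))) 0 = 'D_(v.1, 0) rho p.
  by rewrite derive_line scale0r addr0.
rewrite -d; transitivity ('D_(1 : R) (cst (0 : R)) (0 : R)); last exact: derive_cst.
apply: near_eq_derive; have := near_line (v.1, 0) oU Up; apply: filterS => s Us.
by apply/(SU _ Us); rewrite [_ + _]surjective_pairing /= scaler0 addr0; exact: Sp.
Qed.

(** Along a vertical direction e where rho increases, the nearby fibers of S are graphs in a box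
    around p.2. In each such fiber, a point of B off the graph is interior to B, since a frontier
    point would carry a hyperplane of zeros of rho. If some x of T near p had x.2 interior to B,
    [box_fill] would put the box in B, making p.2 interior. *)
Lemma frontier_open (S T U : set E) (rho : E -> R) (B : set (R * R)) (p v : E) :
  closed B -> (forall w z, frontier B w -> S (z, w)) -> T `<=` S ->
  (forall x, T x -> B x.2) -> frontier B p.2 ->
  open U -> U p -> smooth U rho -> (forall x, U x -> (S x <-> rho x = 0)) ->
  'D_v rho p != 0 ->
  \forall x \near p, T x -> frontier B x.2.
Proof.
move=> cB frS TS TB fp oU Up sr SU v0.
have [Bp nBp] := fp.
have rp : rho p = 0 by apply/(SU _ Up); rewrite [p]surjective_pairing; exact: frS.
have [e De] : exists e : R * R, 0 < 'D_(0, e) rho p.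
  move: v0; rewrite (derive_horizontal v oU Up sr SU); last by move=> z; exact: frS.
  rewrite neq_lt => /orP[h|h]; last by exists v.2.
  exists (- v.2); rewrite (_ : (0, - v.2) = - (0, v.2) :> E); last first.
    by apply: injective_projections; rewrite //= oppr0.
  by rewrite (derive_dirN _ oU Up sr) oppr_gt0.
(* The direction e rotated by a right angle; X and Y are the coordinates in the orthogonal basis (f,
   e) centred at p.2, and n is the squared length of both vectors. *)
pose f : R * R := (- e.2, e.1).
pose n := e.1 ^+ 2 + e.2 ^+ 2.
have n0 : 0 < n.
  rewrite lt_def addr_ge0 ?sqr_ge0 // andbT; apply/negP; rewrite paddr_eq0 ?sqr_ge0 // !sqrf_eq0.
  move=> /andP[/eqP e1 /eqP e2]; move: De.
  rewrite (_ : (0, e) = 0 :> E) ?derive0 ?ltxx //.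
  by apply: injective_projections => //=; apply: injective_projections.
pose X (w : R * R) := ((w.1 - p.2.1) * - e.2 + (w.2 - p.2.2) * e.1) / n.
pose Y (w : R * R) := ((w.1 - p.2.1) * e.1 + (w.2 - p.2.2) * e.2) / n.
pose pt (x y : R) := p.2 + (x *: f + y *: e).
have ptXY w : pt (X w) (Y w) = w.
  apply: injective_projections; rewrite /pt /X /Y /n /= /GRing.scale /=; field; exact: lt0r_neq0.
have cX : continuous X.
  move=> w; apply: cvgMl; apply: cvgD; apply: cvgMl; apply: cvgB;
   [exact: cvg_fst|exact: cvg_cst|exact: cvg_snd|exact: cvg_cst].
have cY : continuous Y.
  move=> w; apply: cvgMl; apply: cvgD; apply: cvgMl; apply: cvgB;
   [exact: cvg_fst|exact: cvg_cst|exact: cvg_snd|exact: cvg_cst].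
have X0 : X p.2 = 0 by rewrite /X !subrr !mul0r addr0 mul0r.
have Y0 : Y p.2 = 0 by rewrite /Y !subrr !mul0r addr0 mul0r.
have [r r0 Hr] : exists2 r : R, 0 < r & forall q, ball p r q -> U q /\ 0 < 'D_(0, e) rho q.
  have h0 : nbhs p U by exact: open_nbhs_nbhs.
  have cd : {for p, continuous (fun q => 'D_(0, e) rho q)}.
    exact: smooth_continuous (smooth_derive _ sr) Up.
  have h1 := continuous_near_gt cd De.
  by have /nbhs_ballP[r /= r0 H] := @filterI _ _ (nbhs_filter p) _ _ h0 h1; exists r.
pose M := `|f| + `|e| + 1.
have M0 : 0 < M by rewrite ltr_wpDl ?addr_ge0.
pose d := r / (4 * M).
have d0 : 0 < d by rewrite divr_gt0 // mulr_gt0.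
have dM : 4 * (d * M) = r by rewrite /d; field; rewrite gt_eqF.
(* The bound is 3 d rather than d because [mvt_line] is symmetric: from a height in [- d, d], a
   shift of size at most 2 d to either side may occur. *)
have in_ball z x y : ball p.1 r z -> `|x| <= 3 * d -> `|y| <= 3 * d -> ball p r (z, pt x y).
  move=> zr xd yd; apply: ball_pair => //.
  rewrite /pt opprD addrA subrr add0r normrN; apply: le_lt_trans (ler_normD _ _) _.
  rewrite !normrZ.
  have h1 : `|x| * `|f| <= 3 * d * `|f| by rewrite ler_wpM2r.
  have h2 : `|y| * `|e| <= 3 * d * `|e| by rewrite ler_wpM2r.
  rewrite -dM /M; exact: box_bound.
have mono z x y y' : ball p.1 r z -> `|x| <= d -> - d <= y -> y < y' -> y' <= d ->
    rho (z, pt x y) < rho (z, pt x y').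
  move=> zr xd dy yy' y'd.
  have E c : (z, pt x y) + c *: (0, e) = (z, pt x (y + c)) :> E.
    apply: injective_projections; rewrite /= ?scaler0 ?addr0 //.
    by rewrite /pt -!addrA -scalerDl.
  have inb c : `|c| <= `|y' - y| -> ball p r (z, pt x (y + c)).
    have yy0 : 0 < y' - y by rewrite subr_gt0.
    rewrite (gtr0_norm yy0) => cyy; apply: in_ball zr _ _.
      exact: le_triple d0 xd.
    exact: norm_le_triple dy yy' y'd cyy.
  have [|c cd] := @mvt_line _ _ rho (z, pt x y) (0, e) (y' - y).
    by move=> t td; rewrite E; have [Ut _] := Hr _ (inb t td); exact: smooth_derivable sr Ut.
  rewrite !E subrKC => h; rewrite -subr_gt0 h mulr_gt0 ?subr_gt0 //.
  by have [_ +] := Hr _ (inb c cd); exact.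
have pt00 : pt 0 0 = p.2 by rewrite /pt !scale0r !addr0.
have pr : ball p.1 r p.1 by exact: ballxx.
have norm0 : `|0 : R| <= d by rewrite normr0 ltW.
have Nd0 : - d <= 0 by rewrite oppr_le0 ltW.
have normd : `|d| <= d by rewrite gtr0_norm.
have ball_shift y q1 : 0 < q1 -> forall z x, ball p.1 q1 z -> `|x| <= q1 / (2 * M) ->
    ball (p.1, pt 0 y) q1 (z, pt x y).
  move=> q10 z x zq xq; apply: ball_pair => //=.
  rewrite /pt opprD addrACA subrr add0r opprD addrACA subrr addr0 -scalerBl sub0r normrZ normrN.
  have h1 : `|x| * `|f| <= q1 / (2 * M) * `|f| by rewrite ler_wpM2r.
  apply: le_lt_trans h1 _; rewrite mulrAC ltr_pdivrMr ?mulr_gt0 // ltr_pM2l //.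
  exact: lt_double.
(* The sign of rho at the centre of the top edge persists, by continuity, for nearby z and small x;
   this is why the width d' is fixed after the height d. *)
have [q1 q10 top] : exists2 q1 : R, 0 < q1 & forall z x, ball p.1 q1 z -> `|x| <= q1 / (2 * M) ->
    0 < rho (z, pt x d).
  have h : 0 < rho (p.1, pt 0 d).
    by have := mono p.1 0 0 d pr norm0 Nd0 d0 (lexx d); rewrite pt00 -surjective_pairing rp.
  have [|Uq _] := Hr (p.1, pt 0 d); first by apply: in_ball => //; exact: le_triple.
  have /nbhs_ballP[q1 /= q10 Hq] := continuous_near_gt (smooth_continuous sr Uq) h.
  by exists q1 => // z x zq xq; apply: Hq; exact: ball_shift.
have [q2 q20 bot] : exists2 q2 : R, 0 < q2 & forall z x, ball p.1 q2 z -> `|x| <= q2 / (2 * M) ->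
    rho (z, pt x (- d)) < 0.
  have h : rho (p.1, pt 0 (- d)) < 0.
    have Nd : - d < 0 by rewrite oppr_lt0.
    have := mono p.1 0 (- d) 0 pr norm0 (lexx _) Nd (ltW d0).
    by rewrite pt00 -surjective_pairing rp.
  have [|Uq _] := Hr (p.1, pt 0 (- d)).
    by apply: in_ball => //; rewrite ?normrN; exact: le_triple.
  have /nbhs_ballP[q2 /= q20 Hq] := continuous_near_lt (smooth_continuous sr Uq) h.
  by exists q2 => // z x zq xq; apply: Hq; exact: ball_shift.
pose d' := Num.min d (Num.min (q1 / (2 * M)) (q2 / (2 * M))).
have d'0 : 0 < d' by rewrite !lt_min d0 !divr_gt0 ?mulr_gt0.
have d'd : d' <= d by rewrite ge_min lexx.
have d'1 : d' <= q1 / (2 * M) by rewrite !ge_min lexx orbT.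
have d'2 : d' <= q2 / (2 * M) by rewrite !ge_min lexx !orbT.
have near_ball (q : R) : 0 < q -> \forall x \near p, ball p.1 q x.1.
  by move=> q0; apply: near_fst; exact: nbhsx_ballx.
have near_X : \forall w \near p.2, `|X w| < d'.
  have c : {for p.2, continuous (fun w => `|X w|)} by apply: cvg_norm; exact: cX.
  by apply: (continuous_near_lt c); rewrite X0 normr0.
have near_Y : \forall w \near p.2, `|Y w| < d.
  have c : {for p.2, continuous (fun w => `|Y w|)} by apply: cvg_norm; exact: cY.
  by apply: (continuous_near_lt c); rewrite Y0 normr0.
have near2X := near_snd near_X; have near2Y := near_snd near_Y.
have near_r := near_ball _ r0; have near_q1 := near_ball _ q10; have near_q2 := near_ball _ q20.
near=> x => Tx.
have xr : ball p.1 r x.1 by near: x; exact: near_r.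
have x1 : ball p.1 q1 x.1 by near: x; exact: near_q1.
have x2 : ball p.1 q2 x.1 by near: x; exact: near_q2.
have xX : `|X x.2| < d' by near: x; exact: near2X.
have xY : `|Y x.2| < d by near: x; exact: near2Y.
split; first exact: TB.
move=> iBx; apply: nBp.
have fill : forall a b, `|a| <= d' -> - d < b < d -> B (pt a b).
  have rx : rho x = 0.
    have [Ux _] : U x /\ 0 < 'D_(0, e) rho x.
      apply: Hr; rewrite [x]surjective_pairing -(ptXY x.2); apply: in_ball => //.
        apply: le_triple => //; apply: ltW; exact: lt_le_trans xX d'd.
      apply: le_triple => //; exact: ltW.
    by apply/(SU _ Ux); exact: TS.
  apply: (@box_fill _ _ B e f p.2 d d' (fun w => rho (x.1, w)) (X x.2) (Y x.2)) => //.
  - by move=> a b b' ad; apply: mono => //; exact: le_trans ad d'd.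
  - by move=> a ad; apply: top => //; exact: le_trans ad d'1.
  - by move=> a ad; apply: bot => //; exact: le_trans ad d'2.
  - move=> a b ad /andP[bd1 bd2] Bab rab; apply: contrapT => nBab.
    have [Uab _] : U (x.1, pt a b) /\ 0 < 'D_(0, e) rho (x.1, pt a b).
      apply: Hr; apply: in_ball => //; apply: le_triple => //; first exact: le_trans ad d'd.
      by rewrite ler_norml bd1.
    by move/eqP: rab; apply; apply/(SU _ Uab); apply: frS.
  - exact: ltW.
  - by rewrite -ltr_norml.
  - by rewrite -/(pt _ _) ptXY.
  - by rewrite -/(pt _ _) ptXY -surjective_pairing.
have : nbhs p.2 B.
  apply: filterS2 near_X near_Y => w wX wY; rewrite -(ptXY w); apply: fill; first exact: ltW.
  by rewrite -ltr_norml.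
by [].
Unshelve. all: by end_near. Qed.

End LocalStructure.

(** * Hyperplanes in the hypersurface and discs inside them *)

Section Hyperplanes.
Variables (R : realType) (m : nat).
Local Notation V := ('rV[R]_m * 'rV[R]_m)%type.
Local Notation E := (V * (R * R))%type.

(** The polydisc is convex, so the image of a segment joins any point of the disc to G y inside
    S. *)
Lemma disc_component (S : set E) p (G : V -> E) y : holo_disc S G -> polydisc_real y ->
  connected_component S p (G y) -> holo_disc (connected_component S p) G.
Proof.
move=> [sG SG dG] hy Ty; split=> // y' hy'.
rewrite (same_connected_component Ty).
pose g := fun t : R => G (y + t *: (y' - y)).
have inP t : `[(0 : R), 1]%classic t -> polydisc_real (y + t *: (y' - y)).
  by rewrite /= in_itv /= => t01; exact: polydisc_real_convex.
have cg : {within `[(0 : R), 1]%classic, continuous g}.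
  apply: continuous_in_subspaceT => t /set_mem t01.
  apply: (@continuous_comp _ _ _ (fun t : R => y + t *: (y' - y)) G).
    exact: cvg_line.
  exact: smooth_continuous sG (inP t t01).
have cI := connected_continuous_connected (@segment_connected R 0 1) cg.
apply: (@connected_component_max _ S (g @` `[(0 : R), 1]%classic)) => //.
- by exists 0; rewrite /g /= ?in_itv /= ?lexx ?ler01 // scale0r addr0.
- by move=> _ [t t01 <-]; apply: SG; exact: inP.
- by exists 1; rewrite /g /= ?in_itv /= ?lexx ?ler01 // scale1r subrKC.
Qed.

Lemma laminated_component (S : set E) p : laminated S -> laminated (connected_component S p).
Proof.
move=> lS x Tx; have [G [y [hG hy Gy]]] := lS x (connected_component_sub Tx).
exists G, y; split=> //; apply: (disc_component hG hy); by rewrite Gy.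
Qed.

(** Without frontier points, following a segment from a point of B would show that B contains (2,
    0), which lies outside the closed unit disc. *)
Lemma frontier_fiber_union (T : set E) x : T x ->
  (forall x, T x -> x.2.1 ^+ 2 + x.2.2 ^+ 2 <= 1) -> exists w, frontier (fiber_union T) w.
Proof.
move=> Tx T1; apply: contrapT => none.
have sub : fiber_union T `<=` [set w : R * R | w.1 ^+ 2 + w.2 ^+ 2 <= 1].
  rewrite /fiber_union [X in _ `<=` X](closure_id _).1; last first.
    have c : continuous (fun w : R * R => w.1 ^+ 2 + w.2 ^+ 2).
      by move=> w; apply: cvgD; apply: cvgM;
         [exact: cvg_fst|exact: cvg_fst|exact: cvg_snd|exact: cvg_snd].
    exact: (preimage_closed (fun w _ => c w) (@closed_le R 1)).
  by apply: closureS => _ [z Tz <-]; exact: T1.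
have /sub /= : fiber_union T (2, 0).
  apply: (segment_stays (@closed_fiber_union R m T) (fiber_union_sub Tx)) => t _ Bt.
  by apply: contrapT => nB; apply: none; exists (x.2 + t *: ((2, 0) - x.2)).
by rewrite expr0n addr0 => h; have : (2 : R) ^+ 2 <= 1 := h; lra.
Qed.

Lemma hyperplane_sub (S : set E) x z : closed S -> laminated S -> hypersurface_real S ->
  (forall x, S x -> x.2.1 ^+ 2 + x.2.2 ^+ 2 <= 1) -> S x -> S (z, x.2).
Proof.
move=> cS lS hS S1 Sx; pose T := connected_component S x.
have TS : T `<=` S by exact: connected_component_sub.
have Tx : T x by exact: connected_component_refl.
have cT : closed T by exact: component_closed.
have lT : laminated T by exact: laminated_component.
have T1 y : T y -> y.2.1 ^+ 2 + y.2.2 ^+ 2 <= 1 by move=> /TS; exact: S1.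
pose B := fiber_union T.
have cB : closed B by exact: closed_fiber_union.
have fr w z' : frontier B w -> T (z', w) by exact: frontier_in_fibers.
(* N is open in the whole space, so [PE] presents one and the same part of T both as relatively open
   and as relatively closed. *)
pose N := interior [set y | T y -> frontier B y.2].
have PE : T `&` N = T `&` (snd @^-1` frontier B).
  apply/seteqP; split=> y [Ty].
    by move=> /interior_subset h; split=> //; exact: h.
  move=> fy; split=> //.
  have [U [rho [oU Uy sr SU [v v0]]]] := hS y (TS y Ty).
  apply: (@frontier_open R m S T U rho B y v cB) => //.
    by move=> w z' /fr /TS.
  by move=> x0; exact: fiber_union_sub.
suff fx : frontier B x.2 by exact: (TS _ (fr _ z fx)).
suff : (T `&` N) x by rewrite PE => -[].
rewrite (_ : T `&` N = T) //.
apply: (@component_connected _ S x).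
- have [w fw] := frontier_fiber_union Tx T1.
  by exists (x.1, w); rewrite PE; split; [exact: fr|].
- by exists N => //; exact: open_interior.
- exists (snd @^-1` frontier B) => //; apply: preimage_closed; last exact: closed_frontier.
  by move=> y _; exact: snd_continuous.
Qed.

Section Vertical.
Variables (S : set E).
Hypotheses (hS : hypersurface_real S) (hyper : forall x z, S x -> S (z, x.2)).

(* As A is complex linear, a nonzero vertical component could be rescaled to the
   one of v0, along which rho has a nonzero derivative, while rho vanishes on the
   disc. *)
Lemma disc_vertical (G : V -> E) y (A : {linear 'rV[C R]_m -> Cn R m}) :
  holo_disc S G -> polydisc_real y ->
  (forall v, is_derive y v G (real_of_Cn (A (vec_of_real v)))) ->
  forall w, (A w).2 = 0.
Proof.
move=> [sG SG _] hy dA w; apply/eqP/negP => /negP q0.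
have [U [rho [oU Uy sr SU [v0 v0n]]]] := hS (SG y hy).
pose l : C R := (Complex v0.2.1 v0.2.2 : C R) / (A w).2.
pose v := real_of_vec (l *: w).
have vE : vec_of_real v = l *: w by exact: real_of_vecK.
pose u := real_of_Cn (A (vec_of_real v)).
have u2 : u.2 = v0.2.
  have Au : (A (l *: w)).2 = (Complex v0.2.1 v0.2.2 : C R).
    by rewrite linearZ; change (l * (A w).2 = Complex v0.2.1 v0.2.2); rewrite divfK.
  by rewrite /u vE /= Au /= -surjective_pairing.
have dg : is_derive (0 : R) (1 : R) (fun s : R => G (y + s *: v)) u.
  by apply: is_derive_line; rewrite scale0r addr0; exact: dA.
have Ug : U (G (y + (0 : R) *: v)) by rewrite scale0r addr0.
have dr := is_derive_curve (@framedE R m) oU Ug sr dg.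
have d0 : is_derive (0 : R) (1 : R) (rho \o (fun s : R => G (y + s *: v))) 0.
  have ne : \forall s \near (0 : R), cst (0 : R) s = (rho \o (fun s : R => G (y + s *: v))) s.
    have h1 := near_line v (@open_polydisc_real R m) hy.
    have h2 : \forall s \near (0 : R), U (G (y + s *: v)).
      have cg : {for (0 : R), continuous (fun s : R => G (y + s *: v))}.
        apply: (@continuous_comp _ _ _ (fun s : R => y + s *: v) G); first exact: cvg_line.
        by rewrite scale0r addr0; exact: smooth_continuous sG hy.
      by apply: cg; apply: open_nbhs_nbhs.
    apply: filterS2 h1 h2 => s hs Us; apply/esym/SU; first exact: Us.
    exact: SG.
  exact: near_eq_is_derive ne (is_derive_cst _ _ _).
move: v0n; rewrite (derive_horizontal v0 oU Uy sr SU); last first.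
  by move=> z; apply: hyper; exact: SG.
rewrite -u2 -(derive_horizontal u oU Uy sr SU); last first.
  by move=> z; apply: hyper; exact: SG.
have := @derive_val _ _ _ _ _ _ _ dr; rewrite (@derive_val _ _ _ _ _ _ _ d0).
by rewrite scale0r addr0 => <-; rewrite eqxx.
Qed.

Lemma disc_const (G : V -> E) y y' : holo_disc S G -> polydisc_real y -> polydisc_real y' ->
  (G y).2 = (G y').2.
Proof.
move=> hG hy hy'; have [sG SG dG] := hG.
(* Centring at the midpoint makes the symmetric range |s| <= 1 of [mvt_line] cover exactly the
   segment from y to y', which convexity keeps in the polydisc. *)
pose c := y + (2^-1 : R) *: (y' - y); pose v := (2^-1 : R) *: (y' - y).
have inP (s : R) : `|s| <= 1 -> polydisc_real (c + s *: v).
  rewrite ler_norml => /andP[s1 s2].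
  rewrite /c /v -addrA scalerA -scalerDl; apply: polydisc_real_convex => //.
  by apply/andP; split; lra.
have dre z : polydisc_real z -> 'D_v (fun z => cre None (G z)) z = 0.
  move=> hz; have [A [_ dA]] := dG z hz.
  rewrite (@derive_val _ _ _ _ _ _ _ (is_derive_cre None (dA v))).
  by rewrite /= (disc_vertical hG hz dA).
have dim z : polydisc_real z -> 'D_v (fun z => cim None (G z)) z = 0.
  move=> hz; have [A [_ dA]] := dG z hz.
  rewrite (@derive_val _ _ _ _ _ _ _ (is_derive_cim None (dA v))).
  by rewrite /= (disc_vertical hG hz dA).
have line_const (f : V -> R) s : smooth (@polydisc_real R m) f ->
    (forall z, polydisc_real z -> 'D_v f z = 0) -> `|s| <= 1 -> f (c + s *: v) = f c.
  move=> sf df s1; apply/eqP; rewrite -subr_eq0.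
  have [|t ts ->] := @mvt_line _ _ f c v s.
    by move=> t ts; apply: smooth_derivable sf _; apply: inP; exact: le_trans ts s1.
  by rewrite df ?mulr0 //; apply: inP; exact: le_trans ts s1.
have yE : y = c + (-1) *: v by rewrite /c /v scaleN1r addrK.
have y'E : y' = c + 1 *: v.
  have h2 : 2^-1 + 2^-1 = 1 :> R by field.
  by rewrite /c /v scale1r -addrA -scalerDl h2 scale1r subrKC.
have e1 : cre None (G y) = cre None (G y').
  rewrite yE y'E !(line_const (fun z => cre None (G z))) ?normrN1 ?normr1 //;
    exact: smooth_cre hG None.
have e2 : cim None (G y) = cim None (G y').
  rewrite yE y'E !(line_const (fun z => cim None (G z))) ?normrN1 ?normr1 //;
    exact: smooth_cim hG None.
by apply: injective_projections; [exact: e1|exact: e2].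
Qed.

(** With zero vertical part, the injective map A is an invertible m x m matrix on the horizontal
    part, so the disc is tangent to every horizontal direction. *)
Lemma disc_tangent (G : V -> E) y (A : {linear 'rV[C R]_m -> Cn R m}) v :
  holo_disc S G -> polydisc_real y -> (forall u, A u = 0 -> u = 0) ->
  (forall v, is_derive y v G (real_of_Cn (A (vec_of_real v)))) ->
  exists w, is_derive y w G (v, 0).
Proof.
move=> hG hy injA dA.
have A2 := disc_vertical hG hy dA.
pose M := lin1_mx (fst \o A).
have ME u : u *m M = (A u).1 by rewrite mul_rV_lin1.
have Munit : M \in unitmx.
  rewrite -row_free_unit; apply/row_freeP; exists (invmx M).
  rewrite mulmxV // unitmxE unitfE; apply/negP => /det0P[u u0].
  rewrite ME => Au; move/eqP: u0; apply; apply: injA.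
  by apply: injective_projections; rewrite ?Au // A2.
pose w := vec_of_real v *m invmx M.
have wE : (A w).1 = vec_of_real v by rewrite -ME mulmxKV.
exists (real_of_vec w).
have := dA (real_of_vec w); rewrite real_of_vecK.
rewrite (_ : real_of_Cn (A w) = (v, 0)) //.
by apply: injective_projections; rewrite /= ?wE ?vec_of_realK // A2.
Qed.

End Vertical.

End Hyperplanes.

(** * Leaves *)

Section Leaves.
Variables (R : realType) (m : nat).
Local Notation V := ('rV[R]_m * 'rV[R]_m)%type.
Local Notation E := (V * (R * R))%type.
Implicit Types (S : set (Cn R m)) (F : set (set (Cn R m))).

Lemma smooth_hypersurface_real S : smooth_hypersurface S ->
  hypersurface_real (@Cn_of_real R m @^-1` S).
Proof.
move=> hS p Sp; have [U [rho [oU Up sr SU dr]]] := hS _ Sp.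
exists (@Cn_of_real R m @^-1` U), (rho \o @Cn_of_real R m).
split=> //; first exact: open_Cn_of_real.
- move=> x Ux; split=> [Sx|rx].
    have : (S `&` U) (Cn_of_real x) by [].
    by rewrite SU => -[].
  have : [set y | U y /\ rho y = 0] (Cn_of_real x) by [].
  by rewrite -SU => -[].
- have [v] := dr (Cn_of_real p) (conj Sp Up).
  by rewrite Cn_of_realK => hv; exists v.
Qed.

Lemma closed_in_cylinder S : S `<=` cylinder R m ->
  closed_in (closure (cylinder R m)) S -> closed S.
Proof.
move=> SC /closed_subspaceP[W cW WE].
rewrite (_ : S = W `&` closure (cylinder R m)).
  by apply: closedI => //; exact: closed_closure.
rewrite WE; apply/esym/setIidPl => x /SC; exact: subset_closure.
Qed.

Lemma cylinder_real S (x : E) : S `<=` cylinder R m -> S (Cn_of_real x) ->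
  x.2.1 ^+ 2 + x.2.2 ^+ 2 <= 1.
Proof.
move=> SC /SC; rewrite /cylinder /= normC_Complex -[1](_ : 1%:C%C = 1) // ltcR -{1}sqrtr1.
by rewrite ltr_sqrt // => /ltW.
Qed.

Lemma chart_point S U Phi p : foliated_chart S U Phi -> S p -> U p ->
  exists z t, [/\ polydisc z, `]-1, 1[%classic t & Phi z t = p].
Proof.
move=> [_ SU _ _ _] Sp Up; have : (S `&` U) p by [].
by rewrite -SU => -[[z t] [hz ht] <-]; exists z, t.
Qed.

Lemma foliation_laminated S F : complex_foliation S F ->
  laminated (@Cn_of_real R m @^-1` S).
Proof.
move=> [_ charts _] x Sx; have [U [Phi [[ch _] Ux]]] := charts _ Sx.
have [z [t [hz ht zt]]] := chart_point ch Sx Ux.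
exists (fun y => real_of_Cn (Phi (vec_of_real y) t)), (real_of_vec z); split.
- exact: chart_disc ch ht.
- by rewrite /polydisc_real /= real_of_vecK.
- by rewrite real_of_vecK zt Cn_of_realK.
Qed.

Section LeviFlat.
Variables (S : set (Cn R m)) (F : set (set (Cn R m))).
Hypotheses (hS : hypersurface_real (@Cn_of_real R m @^-1` S))
  (hyper : forall x z, S (Cn_of_real x) -> S (Cn_of_real (z, x.2)))
  (hF : complex_foliation S F).

Lemma plaque_const U Phi (t : R) x y : foliated_chart S U Phi -> `]-1, 1[%classic t ->
  plaque Phi t x -> plaque Phi t y -> x.2 = y.2.
Proof.
move=> ch ht [z hz <-] [z' hz' <-]; have hG := chart_disc ch ht.
have hz1 : polydisc_real (real_of_vec z) by rewrite /polydisc_real /= real_of_vecK.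
have hz'1 : polydisc_real (real_of_vec z') by rewrite /polydisc_real /= real_of_vecK.
have := disc_const hS hyper hG hz1 hz'1; rewrite !real_of_vecK.
by case: (Phi z t) (Phi z' t) => [? [? ?]] [? [? ?]] [-> ->].
Qed.

Lemma leaf_sub_hyperplane L p : F L -> L p -> L `<=` hyperplane m p.2.
Proof.
move=> FL Lp x Lx; have [_ _ conn] := hF.
have : forall a b, clos_refl_trans _ (same_plaque S F) a b -> a.2 = b.2.
  move=> a b; elim=> [{}a {}b [U [Phi [t [[ch _] ht pa pb]]]]|//|{}a {}b c _ e1 _ e2].
    exact: plaque_const ch ht pa pb.
  by rewrite e1.
by move=> h; rewrite /hyperplane /=; apply/esym/h/(conn L).
Qed.

(** The horizontal vector (v, 0) is the velocity of a curve inside the plaque through x, along which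
    the chart parameter t is constant. *)
Lemma transverse_derive U Phi Psi (x : E) v : foliated_chart S U Phi ->
  smooth (@Cn_of_real R m @^-1` U) (Psi \o @Cn_of_real R m) ->
  (forall z t, polydisc z -> `]-1, 1[%classic t -> Psi (Phi z t) = (real_of_vec z, t)) ->
  S (Cn_of_real x) -> U (Cn_of_real x) ->
  'D_(v, 0) (fun x => ((Psi \o @Cn_of_real R m) x).2) x = 0.
Proof.
move=> ch sPsi PsiK Sx Ux; have [oU _ _ _ _] := ch.
have [z [t [hz ht zt]]] := chart_point ch Sx Ux.
have hG := chart_disc ch ht.
pose G y := real_of_Cn (Phi (vec_of_real y) t).
pose y := real_of_vec z.
have hy : polydisc_real y by rewrite /polydisc_real /= real_of_vecK.
have Gy : G y = x by rewrite /G real_of_vecK zt Cn_of_realK.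
have [_ _ /(_ y hy)[A [injA dA]]] := hG.
have [w dw] := disc_tangent hS hyper v hG hy injA dA.
have oU' := open_Cn_of_real oU.
have s2 := smooth_linear oU' (@snd_continuous V R) sPsi.
have dg : is_derive (0 : R) (1 : R) (fun s : R => G (y + s *: w)) (v, 0).
  by apply: is_derive_line; rewrite scale0r addr0; exact: dw.
have Ug : (@Cn_of_real R m @^-1` U) (G (y + (0 : R) *: w)).
  by rewrite scale0r addr0 Gy.
have dr := is_derive_curve (@framedE R m) oU' Ug s2 dg.
have ne : \forall s \near (0 : R), cst t s =
    ((fun x => ((Psi \o @Cn_of_real R m) x).2) \o (fun s : R => G (y + s *: w))) s.
  have := near_line w (@open_polydisc_real R m) hy; apply: filterS => s hs /=.
  by rewrite /G real_of_CnK PsiK.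
have d0 := near_eq_is_derive ne (is_derive_cst t (0 : R) (1 : R)).
have := @derive_val _ _ _ _ _ _ _ dr; rewrite (@derive_val _ _ _ _ _ _ _ d0).
by rewrite scale0r addr0 Gy => <-.
Qed.

(** A short horizontal segment from q stays in S and in the chart, and the plaque parameter tau has
    zero derivative along it; its endpoint is therefore on the plaque of q. *)
Lemma leaf_open_in_hyperplane L (q : E) : F L -> L (Cn_of_real q) ->
  \forall x \near q, x.2 = q.2 -> L (Cn_of_real x).
Proof.
move=> FL Lq; have [[cov triv _] charts _] := hF.
have Sq : S (Cn_of_real q) by rewrite -cov; exists L.
have [U [Phi [[ch plaques] Uq]]] := charts _ Sq.
have [oU _ _ [Psi [sPsi PsiK]] _] := ch.
have [z [t [hz ht zt]]] := chart_point ch Sq Uq.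
have [L' FL' sub] := plaques t ht.
have L'q : L' (Cn_of_real q) by apply: sub; exists z.
have LL' : L' = L by apply: triv => //; exists (Cn_of_real q).
have oU' := open_Cn_of_real oU.
have /nbhs_ballP[d /= d0 Hd] := open_nbhs_nbhs (conj oU' Uq).
pose tau x := ((Psi \o @Cn_of_real R m) x).2.
have stau : smooth (@Cn_of_real R m @^-1` U) tau.
  exact: smooth_linear oU' (@snd_continuous V R) sPsi.
apply/nbhs_ballP; exists d => //= x qx xq2.
have inb (s : R) : `|s| <= 1 -> ball q d (q + s *: (x - q)).
  move=> s1; move: qx; rewrite -ball_normE /= opprD addrA subrr add0r normrN normrZ.
  rewrite distrC => h; apply: le_lt_trans h; rewrite -[leRHS]mul1r.
  by apply: ler_wpM2r.
have inS (s : R) : S (Cn_of_real (q + s *: (x - q))).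
  rewrite [_ + _]surjective_pairing /= xq2 subrr scaler0 addr0; exact: hyper.
have xE : x = q + (1 : R) *: (x - q) by rewrite scale1r subrKC.
have dE : x - q = ((x - q).1, 0) by rewrite [LHS]surjective_pairing /= xq2 subrr.
have tauq : tau q = t by rewrite /tau /= -zt PsiK.
have taux : tau x = t.
  rewrite -tauq; apply/eqP; rewrite -subr_eq0 {1}xE.
  have [|c c1 ->] := @mvt_line _ _ tau q (x - q) 1.
    rewrite normr1 => s s1; apply: smooth_derivable stau _; exact: Hd (inb s s1).
  rewrite normr1 in c1.
  have := transverse_derive (x - q).1 ch sPsi PsiK (inS c) (Hd _ (inb c c1)).
  by rewrite -dE => ->; rewrite mulr0.
have Sx : S (Cn_of_real x) by rewrite xE.
have Ux : U (Cn_of_real x) by exact: (Hd x qx).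
have [z' [t' [hz' ht' zt']]] := chart_point ch Sx Ux.
rewrite -LL'; apply: sub; exists z' => //.
by rewrite -zt'; congr Phi; move: taux; rewrite /tau /= -zt' PsiK.
Qed.

(** On a segment inside the hyperplane every leaf leaves an open trace. The traces are disjoint and
    cover the segment, so by connectedness that of L is everything. *)
Lemma hyperplane_sub_leaf L (p : E) : F L -> L (Cn_of_real p) ->
  forall x : E, x.2 = p.2 -> L (Cn_of_real x).
Proof.
move=> FL Lp x xp; have [[cov triv _] _ _] := hF.
have Sp : S (Cn_of_real p) by rewrite -cov; exists L.
pose g := fun t : R => p + t *: (x - p).
have cg : continuous g by move=> t; exact: cvg_line.
have g2 t : (g t).2 = p.2 by rewrite /g /= xp subrr scaler0 addr0.
have open_leaf L' : F L' -> open (g @^-1` (@Cn_of_real R m @^-1` L')).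
  move=> FL'; rewrite openE => t L't.
  have : \forall s \near t, (g s).2 = (g t).2 -> L' (Cn_of_real (g s)).
    exact: cg t _ (leaf_open_in_hyperplane FL' L't).
  apply: filterS => s h.
  exact: h (etrans (g2 s) (esym (g2 t))).
pose B := g @^-1` (@Cn_of_real R m @^-1` L).
(* The complement of the trace of L consists of the traces of the other leaves, which are open. *)
have cB : closed B.
  rewrite -openC openE => t nLt.
  have St : S (Cn_of_real (g t)) by rewrite [g t]surjective_pairing g2; exact: hyper.
  move: St; rewrite -cov => -[L' FL' L't].
  have := open_leaf L' FL'; rewrite openE => /(_ t L't); apply: filterS => s L's Ls.
  by apply: nLt; rewrite /B /preimage /= (triv L L') //; exists (Cn_of_real (g s)).
have BE : `[(0 : R), 1]%classic `&` B = `[(0 : R), 1]%classic.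
  apply: (@segment_connected R 0 1).
  - exists 0; split; first by rewrite /= in_itv /= lexx ler01.
    by rewrite /B /g /preimage /= scale0r addr0.
  - by exists B => //; exact: open_leaf.
  - by exists B.
have : (`[(0 : R), 1]%classic `&` B) 1 by rewrite BE /= in_itv /= ler01 lexx.
by move=> [_]; rewrite /B /g /preimage /= scale1r subrKC.
Qed.

End LeviFlat.

End Leaves.

Theorem theorem0p1 (R : realType) (m : nat) (S : set (Cn R m))
    (hS : levi_flat S)
    (hC : S `<=` cylinder R m)
    (hcl : closed_in (closure (cylinder R m)) S)
    (F : set (set (Cn R m))) (hF : complex_foliation S F) :
  forall L : set (Cn R m), F L -> exists c : C R, L = hyperplane m c.
Proof.
move=> L FL; have [[_ _ ne] _ _] := hF; have [p Lp] := ne L FL.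
have hSR := smooth_hypersurface_real hS.1.
have cSR : closed (@Cn_of_real R m @^-1` S).
  apply: preimage_closed; last exact: closed_in_cylinder hC hcl.
  by move=> x _; exact: Cn_of_real_continuous.
have hyper x z : S (Cn_of_real x) -> S (Cn_of_real (z, x.2)).
  apply: (hyperplane_sub z cSR (foliation_laminated hF) hSR) => y.
  exact: cylinder_real hC.
exists p.2; apply/seteqP; split.
  have := leaf_sub_hyperplane hSR hyper hF FL Lp; exact.
move=> x xp; rewrite -(real_of_CnK x).
apply: (hyperplane_sub_leaf hSR hyper hF FL (p := real_of_Cn p)).
  by rewrite real_of_CnK.
by rewrite /real_of_Cn /= xp.
Qed.
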